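(* Let $E$ be a Banach space, let $A_1,A_2$ be generators of strongly continuous semigroups $(T_1(t))_{t\ge0}$, $(T_2(t))_{t\ge0}$ on $E$, let $F=\mathrm{C}_0(\mathbb{R}_+;E)$, and on $\mathcal{E}=E\times F\times F$ let $$\mathcal{A}_1=\begin{pmatrix}A_1&\delta_0&0\\0&\frac{\mathrm d}{\mathrm ds}&0\\0&0&0\end{pmatrix},\ D(\mathcal{A}_1)=D(A_1)\times D(\tfrac{\mathrm d}{\mathrm ds})\times F,\qquad \mathcal{A}_2=\begin{pmatrix}A_2&0&\delta_0\\0&0&0\\0&0&\frac{\mathrm d}{\mathrm ds}\end{pmatrix},\ D(\mathcal{A}_2)=D(A_2)\times F\times D(\tfrac{\mathrm d}{\mathrm ds}),$$ with $D(\frac{\mathrm d}{\mathrm ds})=\mathrm{C}_0^1(\mathbb{R}_+;E)$, and let $(\mathcal{T}_1(t))_{t\ge0}$, $(\mathcal{T}_2(t))_{t\ge0}$ be the strongly continuous semigroups generated by $\mathcal{A}_1,\mathcal{A}_2$. Suppose that for some $M'\ge1$ and $\omega'\ge0$ one has $$\|(T_2(\tfrac tn)T_1(\tfrac tn))^n\|\le M'\mathrm{e}^{t\omega'}\quad\text{for all }t\ge0\text{ and }n\in\mathbb{N}.$$ Then there exist $M\ge1$ and $\omega\in\mathbb{R}$ such that $$\bigl\|\bigl(\mathcal{T}_2(\tfrac tn)\mathcal{T}_1(\tfrac tn)\bigr)^n\bigr\|\le M\mathrm{e}^{t\omega}\quad\text{for all }t\ge0\text{ and }n\in\mathbb{N}.$$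 Moreover, if $\mathcal{A}:=\overline{\mathcal{A}_1+\mathcal{A}_2}$ is the generator of a strongly continuous semigroup $(\mathcal{T}(t))_{t\ge0}$ on $\mathcal{E}$, then for all $x\in\mathcal{E}$ and $t\ge0$ $$\mathcal{T}(t)x=\lim_{n\to\infty}\bigl(\mathcal{T}_2(\tfrac tn)\mathcal{T}_1(\tfrac tn)\bigr)^nx\quad\text{and}\quad\mathcal{T}(t)x=\lim_{n\to\infty}\bigl(\mathcal{T}_1(\tfrac t{2n})\mathcal{T}_2(\tfrac tn)\mathcal{T}_1(\tfrac t{2n})\bigr)^nx.$$
   Context: $\mathrm{C}_0(\mathbb{R}_+;E)$ is the space of continuous $E$-valued functions on $\mathbb{R}_+=[0,\infty)$ vanishing at infinity, with the supremum norm; $\frac{\mathrm d}{\mathrm ds}$ with domain $\mathrm{C}^1_0(\mathbb{R}_+;E)=\{f\in \mathrm{C}_0(\mathbb{R}_+;E): f\in \mathrm{C}^1,\ f'\in \mathrm{C}_0(\mathbb{R}_+;E)\}$ is the generator of the left-shift semigroup $(L(t)f)(s)=f(s+t)$ on $F$; $\delta_0f:=f(0)$ is point evaluation at $0$. The operators $\mathcal{A}_1,\mathcal{A}_2$ do generate strongly continuous semigroups on $\mathcal{E}$. $\overline{\mathcal{A}_1+\mathcal{A}_2}$ is the closure of the sum defined on $D(\mathcal{A}_1)\cap D(\mathcal{A}_2)$. $\mathbb{N}=\{1,2,\dots\}$. *)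

(* Defs.v *)
From HB Require Import structures.
From mathcomp Require Import all_boot all_order all_algebra.
From mathcomp Require Import all_classical all_reals all_analysis.

Set Implicit Arguments.
Unset Strict Implicit.
Unset Printing Implicit Defensive.
Import Order.TTheory GRing.Theory Num.Theory.
Import numFieldNormedType.Exports.
Local Open Scope classical_set_scope.
Local Open Scope ring_scope.

(* The scalar field is R throughout; a complex Banach space is covered by
   restriction of scalars. *)

(* A function on R_+ = [0, +oo[ is represented by its extension by 0 to the
   whole of R, so that Leibniz equality is equality on R_+. *)
Definition C0_set (R : realType) (E : normedModType R) : set (R -> E) :=
  [set f | [/\ forall s : R, s < 0 -> f s = 0,
               {within `[0, +oo[, continuous f} &
               f s @[s --> +oo] --> (0 : E)]].

Definition C0_pred (R : realType) (E : normedModType R) : {pred (R -> E)} :=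
  mem (@C0_set R E).

Section C0_lmodule.
Variables (R : realType) (E : normedModType R).

Lemma C0_submod_closed : submod_closed (@C0_pred R E).
Proof.
split.
  rewrite inE; split => //.
    by apply: continuous_subspaceT => x; exact: cvg_cst.
  exact: cvg_cst.
move=> a f g; rewrite !inE => -[f0 fc fo] [g0 gc go]; split.
- by move=> s s0; rewrite !fctE f0// g0// scaler0 addr0.
- move=> x; apply: cvgD; last exact: gc.
  by apply: cvgZl_tmp; exact: fc.
- rewrite -[0 : E]addr0; apply: cvgD; last exact: go.
  by rewrite -[0 : E](scaler0 _ a); apply: cvgZl_tmp; exact: fo.
Qed.

HB.instance Definition _ :=
  GRing.isSubmodClosed.Build R (R -> E) (@C0_pred R E) C0_submod_closed.

Record C0 : predArgType := MkC0 { C0_fun :> R -> E; _ : C0_fun \in @C0_pred R E }.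

HB.instance Definition _ := [isSub for C0_fun].
HB.instance Definition _ := [Choice of C0 by <:].
HB.instance Definition _ := [SubChoice_isSubLmodule of C0 by <:].

End C0_lmodule.

Section C0_normed.
Variables (R : realType) (E : normedModType R).
Implicit Types f g : C0 E.

Lemma C0P f : C0_set (f : R -> E).
Proof. by have := valP f; rewrite inE. Qed.

Definition C0_values f : set R := [set `|f s| | s in `[0, +oo[ ].

Definition C0_norm f : R := sup (C0_values f).

Lemma C0_has_sup f : has_sup (C0_values f).
Proof.
split; first by exists `|f 0|, 0 => //=; rewrite in_itv /= lexx.
have [_ fc fo] := C0P f.
have : \forall s \near +oo, `|f s| <= 1.
  have /cvgrPdist_le /(_ 1 ltr01) := fo.
  by apply: filterS => s; rewrite sub0r normrN.
move=> [M [_ hM]].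
have cf : {within `[0, M], continuous f}.
  by apply: continuous_subspaceW fc => s; rewrite /= !in_itv /= => /andP[->].
have [K [_ hK]] :=
  compact_bounded (continuous_compact cf (@segment_compact R 0 M)).
exists (Num.max 1 (K + 1)) => _ [s /= + <-]; rewrite in_itv /= andbT => s0.
have [sM|Ms] := leP s M; last by rewrite le_max hM.
rewrite le_max (hK (K + 1)) ?orbT ?ltrDl//.
by exists s => //=; rewrite in_itv /= s0.
Qed.

Lemma C0_norm_ub f s : 0 <= s -> `|f s| <= C0_norm f.
Proof.
move=> s0; apply: sup_upper_bound; first exact: C0_has_sup.
by exists s => //=; rewrite in_itv /= s0.
Qed.

Lemma C0_norm_le f (c : R) :
  (forall s, 0 <= s -> `|f s| <= c) -> C0_norm f <= c.
Proof.
move=> h; apply: ge_sup; first by case: (C0_has_sup f).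
by move=> _ [s /= + <-]; rewrite in_itv /= andbT; exact: h.
Qed.

Lemma C0_ler_normD f g : C0_norm (f + g) <= C0_norm f + C0_norm g.
Proof.
apply: C0_norm_le => s s0.
by rewrite (le_trans (ler_normD (f s) (g s)))// lerD// C0_norm_ub.
Qed.

Lemma C0_normrZ (l : R) f : C0_norm (l *: f) = `|l| * C0_norm f.
Proof.
have le_norm (k : R) g : C0_norm (k *: g) <= `|k| * C0_norm g.
  apply: C0_norm_le => s s0.
  by rewrite (_ : (k *: g) s = k *: g s)// normrZ ler_wpM2l// C0_norm_ub.
apply/eqP; rewrite eq_le le_norm /=.
have [->|l0] := eqVneq l 0.
  by rewrite normr0 mul0r (le_trans _ (C0_norm_ub _ (lexx 0))).
rewrite -ler_pdivlMl ?normr_gt0// -normfV.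
by rewrite -{1}[f](scalerK l0); exact: le_norm.
Qed.

Lemma C0_normr0_eq0 f : C0_norm f = 0 -> f = 0.
Proof.
move=> f0; apply/val_inj/funext => s /=.
have [s0|s0] := ltP s 0; first by have [->] := C0P f.
by apply/normr0_eq0/le_anti; rewrite normr_ge0 andbT -f0 C0_norm_ub.
Qed.

HB.instance Definition _ := @Lmodule_isNormed.Build R (C0 E)
  C0_norm C0_ler_normD C0_normrZ C0_normr0_eq0.

End C0_normed.

(* A possibly unbounded operator A on X is its graph: (x, y) \in A means
   x \in D(A) and A x = y. *)
Notation operator X := (set (X * X)%type).

Definition op_sum (R : realType) (X : normedModType R) (A B : operator X)
    : operator X :=
  [set p | exists y z, [/\ A (p.1, y), B (p.1, z) & p.2 = y + z]].

(* The closure of an operator, as the closure of its graph in X * X. If it is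
   not single-valued then it generates no semigroup. *)
Definition op_closure (R : realType) (X : normedModType R) (A : operator X)
    : operator X :=
  closure A.

Definition op_norm (R : realType) (X : normedModType R) (S : X -> X) : \bar R :=
  ereal_sup [set (`|S x|)%:E | x in [set x : X | `|x| <= 1]].

(* T t is only meaningful for 0 <= t. *)
Record c0_semigroup (R : realType) (X : normedModType R) (T : R -> X -> X)
    : Prop := {
  c0_linear : forall t, 0 <= t -> linear (T t);
  c0_bounded : forall t, 0 <= t -> (op_norm (T t) < +oo)%E;
  c0_0 : forall x, T 0 x = x;
  c0_D : forall s t x, 0 <= s -> 0 <= t -> T (s + t) x = T s (T t x);
  c0_continuous : forall x, {within `[0, +oo[, continuous (T ^~ x)}
}.

Definition generator (R : realType) (X : normedModType R) (T : R -> X -> X)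
    : operator X :=
  [set p | h^-1 *: (T h p.1 - p.1) @[h --> 0^'+] --> p.2].

Definition generates (R : realType) (X : normedModType R) (A : operator X)
    (T : R -> X -> X) : Prop :=
  c0_semigroup T /\ A = generator T.

(* d/ds on C^1_0(R_+; E): since the derivative is required to be an element of
   C_0(R_+; E), the domain is exactly C^1_0. Difference quotients are taken
   within R_+, hence the derivative at 0 is one-sided. *)
Definition ddsOp (R : realType) (E : normedModType R) : operator (C0 E) :=
  [set p : C0 E * C0 E | forall s : R, 0 <= s ->
    h^-1 *: (p.1 (s + h) - p.1 s)
      @[h --> within [set h | 0 <= s + h] 0^'] --> p.2 s].

Definition delta0 (R : realType) (E : normedModType R) (f : C0 E) : E := f 0.

Definition calE (R : realType) (E : normedModType R) : normedModType R :=
  (E * C0 E * C0 E)%type.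

Definition calA1 (R : realType) (E : normedModType R) (A1 : operator E)
    : operator (calE E) :=
  [set p : calE E * calE E | exists x f g y f',
    [/\ A1 (x, y), ddsOp (f, f'), p.1 = (x, f, g)
      & p.2 = (y + delta0 f, f', 0)]].

Definition calA2 (R : realType) (E : normedModType R) (A2 : operator E)
    : operator (calE E) :=
  [set p : calE E * calE E | exists x f g y g',
    [/\ A2 (x, y), ddsOp (g, g'), p.1 = (x, f, g)
      & p.2 = (y + delta0 g, 0, g')]].

(* Main.v *)
Require Import Defs.
From HB Require Import structures.
From mathcomp Require Import all_boot all_order all_algebra.
From mathcomp Require Import all_classical all_reals all_analysis.
From mathcomp Require Import lra ring.

Set Implicit Arguments.
Unset Strict Implicit.
Unset Printing Implicit Defensive.
Import Order.TTheory GRing.Theory Num.Theory.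
Import numFieldNormedType.Exports.
Local Open Scope classical_set_scope.
Local Open Scope ring_scope.

(** The matrix semigroups are triangular. An orbit (x, f, g) of calA1 keeps g
fixed, shifts f to the left, and its first component solves
x' = A1 x + f(t), so that by Duhamel it differs from T1(t) x(0) by at most
t K |f|, where K bounds T1 on [0, t]; likewise for calA2 with f and g
exchanged (triangular_orbit).

Stability. Along the iterates z_k = (x_k, f_k, g_k) of S2(h) S1(h) the norms
of f_k and g_k do not grow, hence x_(k+1) = T2(h) T1(h) x_k + O(h |z_0|). The
assumed bound on the powers of T2(h) T1(h) absorbs the accumulated n = t / h
errors of size O(h), by telescoping (iter_telescope, calE_splitting_stable).

Convergence. The first formula is then an instance of the Chernoff product
formula for F(h) = S2(h) S1(h) (chernoff). It is proved here without
resolvents. For x in the domain of the limit generator G the orbit T(s) x is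
continuous in the graph norm of G. Take finitely many equidistant nodes and
approximate the orbit there, in the graph norm, by vectors y_j of the core,
that is of the domain of calA1 + calA2. The polygon through the y_j stays in
the core, where F is consistent, so for small h each step of F(h) follows an edge
up to h times a quantity that vanishes with the mesh (block_estimate).
Stability turns this into convergence for x in the domain of G, and density of
that domain into convergence for every x. The symmetric scheme
S1(h/2) S2(h) S1(h/2) is intertwined by S1(h/2) with F(h), and so inherits both
its stability and its limit (strang_limit).

The calculus of vector-valued functions that this requires rests on two
facts. A continuous function whose right difference quotients are bounded by c
is Lipschitz with constant c (mean_value); this gives uniqueness for
abstract Cauchy problems and the Duhamel estimate without any integral. A
continuous function with values in a Banach space has a primitive
(primitive_exists); this yields the density of the domain of a generator. *)

(** * Functions on the half-line with values in a normed space *)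

(** Completeness of the real line in the form that suits proofs that progress from
left to right: a property that starts at a, extends a little beyond each point
where it holds, and passes to left limits, reaches b. *)
Lemma real_induction (R : realType) (P : R -> Prop) (a b : R) :
  a <= b -> P a ->
  (forall s : R, a <= s < b -> P s ->
     exists2 d : R, 0 < d & forall h : R, 0 < h < d -> P (s + h)) ->
  (forall s : R, a < s <= b -> (forall r : R, a <= r < s -> P r) -> P s) ->
  forall s : R, a <= s <= b -> P s.
Proof.
move=> ab Pa Pr Pl.
pose S := [set s : R | a <= s <= b /\ forall r : R, a <= r <= s -> P r].
have Sa : S a.
  split=> [|r /andP[ar ra]]; first by rewrite lexx ab.
  by have -> : r = a by apply/le_anti; rewrite ar ra.
have supS : has_sup S.
  by split; [exists a | exists b => s [/andP[]]].
pose c := sup S.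
have ac : a <= c by exact: sup_upper_bound.
have cb : c <= b by apply: ge_sup; [exists a | move=> s [/andP[]]].
have below r : a <= r < c -> P r.
  move=> /andP[ar rc].
  have [e Se re] := sup_adherent (eps := c - r) ltac:(by rewrite subr_gt0) supS.
  by case: Se => _; apply; rewrite ar/= ltW//; move: re; rewrite /c; lra.
have Pc : P c.
  have [ca|ac'] := leP c a.
    by have -> : c = a by apply/le_anti; rewrite ca.
  by apply: Pl; rewrite ?ac'.
have upto r : a <= r <= c -> P r.
  by move=> /andP[ar]; rewrite le_eqVlt => /predU1P[->//|rc]; apply: below; rewrite ar.
suff cE : c = b by rewrite -cE.
apply/le_anti; rewrite cb/= leNgt; apply/negP => cltb.
have [d d0 hd] := Pr c ltac:(by rewrite ac cltb) Pc.
pose h := Num.min (d / 2) (b - c).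
have h0 : 0 < h by rewrite lt_min divr_gt0//= subr_gt0.
have hdd : h < d by rewrite gt_min; apply/orP; left; lra.
have hb : c + h <= b by rewrite -lerBrDl ge_min lexx orbT.
suff : S (c + h) by move=> /(sup_upper_bound supS); rewrite -/c; lra.
split=> [|r /andP[ar rch]]; first by rewrite hb andbT; lra.
have [rc|cr] := leP r c; first by apply: upto; rewrite ar.
have -> : r = c + (r - c) by lra.
by apply: hd; lra.
Qed.

Section HalfLine.
Variables (R : realType) (X : normedModType R).
Implicit Types u v : R -> X.

(** Continuity on [0, +oo[ relative to that half-line, with the modulus given by a
non-strict inequality, as estimates use it (see cont0yP). *)
Definition cont0y u := forall s e : R, 0 <= s -> 0 < e ->
  exists2 d : R, 0 < d & forall r : R, 0 <= r -> `|r - s| < d -> `|u r - u s| <= e.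

(** The function u has right derivative z at s. The remainder is not divided by h, so that
bounds on it add up along a sum of functions. *)
Definition rderive u (s : R) (z : X) := forall e : R, 0 < e ->
  exists2 d : R, 0 < d & forall h : R, 0 < h < d -> `|u (s + h) - u s - h *: z| <= h * e.

Lemma cont0yP u : {within `[0, +oo[, continuous u} <-> cont0y u.
Proof.
split.
  move=> cu s e s0 e0.
  have /subspace_continuousP/(_ s) := cu.
  rewrite /= in_itv/= s0 => /(_ isT)/cvgrPdist_le/(_ e e0).
  rewrite -filter_from_ballE => -[d /= d0 hd].
  exists d => // r r0 rs; rewrite distrC; apply: hd => /=; last by rewrite in_itv/= r0.
  by rewrite /ball/= distrC.
move=> cu; apply/subspace_continuousP => s /=; rewrite in_itv/= andbT => s0.
apply/cvgrPdist_le => e e0.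
have [d d0 hd] := cu s e s0 e0.
rewrite -filter_from_ballE; exists d => //= r; rewrite /ball/= => sr.
by rewrite in_itv/= andbT => r0; rewrite distrC; apply: hd => //; rewrite distrC.
Qed.

(** The bound with c + e propagates to the right by assumption and through left
limits by continuity; then e tends to 0. Only a bound on the right difference
quotients is involved, so this applies to orbits of semigroups, which come with
one-sided derivatives. *)
Lemma mean_value u (a b c : R) : 0 <= a <= b -> cont0y u ->
  (forall s : R, a <= s < b -> forall e : R, 0 < e ->
     exists2 d : R, 0 < d & forall h : R, 0 < h < d -> `|u (s + h) - u s| <= h * (c + e)) ->
  `|u b - u a| <= (b - a) * c.
Proof.
move=> /andP[a0 ab] cu du.
suff H e : 0 < e -> `|u b - u a| <= (b - a) * (c + e).
  apply/ler_addgt0Pr => e e0.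
  have ba1 : 0 < b - a + 1 by lra.
  have := H (e / (b - a + 1)) (divr_gt0 e0 ba1).
  move=> /le_trans; apply; rewrite mulrDr lerD2l mulrCA.
  by apply: ler_piMr; [exact: ltW | rewrite ler_pdivrMr// mul1r; lra].
move=> e0.
apply: (@real_induction R (fun s => `|u s - u a| <= (s - a) * (c + e)) a b ab).
- by rewrite !subrr normr0 mul0r.
- move=> s sab Ps; have [d d0 hd] := du s sab e e0.
  exists d => // h hh; have -> : u (s + h) - u a = (u (s + h) - u s) + (u s - u a).
    by rewrite addrA subrK.
  by apply: (le_trans (ler_normD _ _)); have := hd h hh; lra.
- move=> s /andP[as_ sb] Pr.
  apply/ler_addgt0Pr => k k0.
  have k20 : 0 < k / 2 by lra.
  have [d d0 hd] := cu s (k / 2) ltac:(lra) k20.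
  (* At s - h the bound is known; h is small enough that neither u nor the bound
     moves by more than k / 2 between s - h and s. *)
  pose M := `|c + e| + 1.
  have M0 : 0 < M by rewrite /M; have := normr_ge0 (c + e); lra.
  pose h := Num.min (d / 2) (Num.min (s - a) (k / 2 / M)).
  have h0 : 0 < h by rewrite !lt_min !divr_gt0//= subr_gt0 as_.
  have hdd : h < d by rewrite gt_min; apply/orP; left; lra.
  have hsa : h <= s - a by rewrite !ge_min lexx !orbT.
  have hk : h * M <= k / 2 by rewrite -ler_pdivlMr// !ge_min lexx !orbT.
  have := hd (s - h) ltac:(lra).
  rewrite (_ : s - h - s = - h); last by lra.
  rewrite normrN gtr0_norm// => /(_ hdd) H1.
  have H2 := Pr (s - h) ltac:(lra).
  have -> : u s - u a = (u s - u (s - h)) + (u (s - h) - u a) by rewrite addrA subrK.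
  apply: (le_trans (ler_normD _ _)); rewrite [`|u s - _|]distrC.
  have : - (h * (c + e)) <= h * M.
    rewrite -mulrN ler_pM2l// /M; have := ler_norm (- (c + e)); rewrite normrN; lra.
  lra.
- by rewrite ab lexx.
Qed.

Lemma cont0y_rderive_eq0 u : cont0y u -> (forall s : R, 0 <= s -> rderive u s 0) ->
  forall t, 0 <= t -> u t = u 0.
Proof.
move=> cu du t t0; apply/eqP; rewrite -subr_eq0 -normr_le0.
rewrite -[leRHS](mulr0 (t - 0)).
apply: (@mean_value u 0 t 0) => //; first by rewrite lexx.
move=> s /andP[s0 _] e e0; have [d d0 hd] := du s s0 e e0.
by exists d => // h hh; have := hd h hh; rewrite scaler0 subr0 add0r.
Qed.

Lemma cont0y_bounded u t : cont0y u ->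
  exists2 K : R, 0 <= K & forall s : R, 0 <= s <= t -> `|u s| <= K.
Proof.
move=> /cont0yP cu.
have ct : {within `[0, t], continuous u}.
  by apply: continuous_subspaceW cu => s; rewrite /= !in_itv /= => /andP[->].
have [K [_ hK]] :=
  compact_bounded (continuous_compact ct (@segment_compact R 0 t)).
exists (`|K| + 1) => [|s st]; first by have := normr_ge0 K; lra.
apply: (hK (`|K| + 1)); first by have := ler_norm K; lra.
by exists s => //=; rewrite in_itv.
Qed.

(** Heine's theorem, by extending the interval of uniform continuity past a point c
around which u oscillates by at most e / 2 on each side. *)
Lemma cont0y_unif u t e : 0 <= t -> cont0y u -> 0 < e ->
  exists2 d : R, 0 < d & forall r s : R, 0 <= r <= t -> 0 <= s <= t -> `|r - s| < d ->
    `|u r - u s| <= e.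
Proof.
move=> t0 cu e0.
have e20 : 0 < e / 2 by lra.
pose P q := exists2 d : R, 0 < d & forall r s : R, 0 <= r <= q -> 0 <= s <= q ->
  `|r - s| < d -> `|u r - u s| <= e.
have glue p q c d : 0 <= p -> 0 < d -> P p ->
    (forall r : R, 0 <= r -> p - d <= r <= q -> `|u r - u c| <= e / 2) -> P q.
  move=> p0 d0 [d' d'0 hp] hc.
  exists (Num.min d' d) => [|r s rq sq]; first by rewrite lt_min d'0.
  rewrite lt_min => /andP[rsd']; rewrite ltr_norml => rsd.
  have [/andP[rp sp]|] := boolP ((r <= p) && (s <= p)).
    by apply: hp => //; lra.
  rewrite negb_and -!ltNge => rsp.
  have := hc r ltac:(lra) ltac:(case/orP: rsp => rsp; lra).
  have := hc s ltac:(lra) ltac:(case/orP: rsp => rsp; lra).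
  by have := ler_distD (u c) (u r) (u s); rewrite [X in _ <= _ + X]distrC; lra.
apply: (@real_induction R P 0 t t0); last by rewrite t0 lexx.
- exists 1 => // r s r0 s0 _.
  by rewrite (_ : r = s) ?subrr ?normr0 ?ltW//; lra.
- move=> s /andP[s0 _] Ps.
  have [d d0 hd] := cu s _ s0 e20; exists d => // h hh.
  apply: (glue s _ s (d / 2)) => //; first by lra.
  by move=> r r0 rs; apply: hd => //; rewrite ltr_norml; lra.
- move=> s /andP[s0 _] hs.
  have [d d0 hd] := cu s _ (ltW s0) e20.
  pose p := Num.max 0 (s - d / 2).
  have ps : 0 <= p < s by rewrite le_max lexx gt_max/= s0; lra.
  have pd : s - d / 2 <= p by rewrite le_max lexx orbT.
  apply: (glue p _ s (d / 4)); [lra|lra|exact: hs|].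
  by move=> r r0 rs; apply: hd => //; rewrite ltr_norml; lra.
Qed.

End HalfLine.

(** * Primitives of continuous functions *)

Lemma near_invS_le (R : realType) (K e : R) : 0 < e -> \forall m \near \oo, K / m.+1%:R <= e.
Proof.
move=> e0; near=> m.
have M0 : 0 < (m.+1%:R : R) by rewrite ltr0n.
rewrite ler_pdivrMr// -ler_pdivrMl// mulrC.
apply: (@le_trans _ _ m%:R); last by rewrite ler_nat.
by near: m; exact: nbhs_infty_ger.
Unshelve. all: by end_near. Qed.

Section Primitive.
Variables (R : realType) (X : completeNormedModType R) (u : R -> X).
Hypothesis cu : cont0y u.

(** Right-endpoint sum with mesh 1 / (m + 1) over the grid points in ]0, t]. Since the
grid does not depend on t, increments in t are again such sums. *)
Definition riemann_sum (m : nat) (t : R) : X :=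
  \sum_(0 <= k < Num.truncn (t * m.+1%:R)) m.+1%:R^-1 *: u (k.+1%:R / m.+1%:R).

(** The sum over ]s, t] has about (t - s)(m + 1) terms, each within e of v; counting
them with an error of at most one gives the term in 1 / (m + 1). This single
estimate provides both the Cauchy property of the sums and, in the limit, the
derivative of the primitive. *)
Lemma riemann_sum_increment (m : nat) (s t e : R) (v : X) :
  0 <= s <= t -> 0 <= e -> (forall r, s <= r <= t -> `|u r - v| <= e) ->
  `|riemann_sum m t - riemann_sum m s - (t - s) *: v| <= (t - s) * e + (e + `|v|) / m.+1%:R.
Proof.
move=> /andP[s0 st] e0 hv.
set M : R := m.+1%:R; have M0 : 0 < M by rewrite ltr0n.
have [/andP[Ns1 Ns2] /andP[Nt1 Nt2]] :
    ((Num.truncn (s * M))%:R <= s * M < (Num.truncn (s * M)).+1%:R)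
    /\ ((Num.truncn (t * M))%:R <= t * M < (Num.truncn (t * M)).+1%:R).
  by split; apply: truncn_itv; apply: mulr_ge0; lra.
rewrite /riemann_sum -/M; set Ns := Num.truncn (s * M) in Ns1 Ns2 *.
set Nt := Num.truncn (t * M) in Nt1 Nt2 *.
have NsNt : (Ns <= Nt)%N by apply: le_truncn; rewrite ler_pM2r.
rewrite (big_cat_nat (leq0n Ns) NsNt)/= [\sum_(0 <= k < Ns) _ + _]addrC addrK.
pose D : R := (Nt - Ns)%:R.
have DE : D = Nt%:R - Ns%:R by rewrite /D natrB.
have -> : \sum_(Ns <= k < Nt) M^-1 *: u (k.+1%:R / M) - (t - s) *: v =
    \sum_(Ns <= k < Nt) M^-1 *: (u (k.+1%:R / M) - v)
    + (D / M - (t - s)) *: v.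
  under [in RHS]eq_bigr do rewrite scalerBr.
  rewrite sumrB sumr_const_nat -scaler_nat scalerA [in RHS]scalerBl -/D.
  by rewrite addrA subrK.
rewrite -natr1 in Ns2; rewrite -natr1 in Nt2.
apply: (le_trans (ler_normD _ _)); rewrite normrZ.
have H1 : `|\sum_(Ns <= k < Nt) M^-1 *: (u (k.+1%:R / M) - v)| <= D / M * e.
  apply: (le_trans (ler_norm_sum _ _ _)).
  have -> : D / M * e = \sum_(Ns <= k < Nt) M^-1 * e.
    by rewrite sumr_const_nat -mulr_natl mulrA.
  rewrite big_nat_cond [leRHS]big_nat_cond; apply: ler_sum => k /andP[/andP[Nk kN] _].
  rewrite normrZ gtr0_norm ?invr_gt0// ler_pM2l ?invr_gt0//; apply: hv.
  rewrite ler_pdivlMr// ler_pdivrMr//.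
  have : (Ns.+1%:R : R) <= k.+1%:R by rewrite ler_nat ltnS.
  have : (k.+1%:R : R) <= Nt%:R by rewrite ler_nat.
  by rewrite -[Ns.+1%:R]natr1; lra.
have H2 : D / M <= (t - s) + M^-1.
  by rewrite ler_pdivrMr// mulrDl mulVf ?gt_eqF//; rewrite DE; lra.
have H3 : `|D / M - (t - s)| <= M^-1.
  rewrite ler_distl; apply/andP; split; last by [].
  by rewrite ler_pdivlMr// mulrBl mulVf ?gt_eqF// DE; lra.
have := ler_wpM2r e0 H2; have := ler_wpM2r (normr_ge0 v) H3.
move: H1; move: (`|\sum_(_ <= _ < _) _|) => S H1.
move: (D / M) H1 => Q H1; move: (M^-1) => I; lra.
Qed.

Lemma riemann_sum_cvg t : 0 <= t -> cvg (riemann_sum ^~ t @ \oo).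
Proof.
move=> t0; apply: cauchy_cvg; apply: cauchy_exP => e e0.
have [B B0 hB] := cont0y_bounded t cu.
pose e' := e / (2 * (t + 1)); have e'0 : 0 < e' by rewrite divr_gt0//; lra.
have e'E : (t + 1) * e' = e / 2 by rewrite /e'; field; lra.
clearbody e'.
have [d d0 hd] := cont0y_unif t0 cu e'0.
pose K := (Num.truncn (t / d)).+1; pose h := t / K%:R.
have K0 : 0 < (K%:R : R) by rewrite ltr0n.
have h0 : 0 <= h by rewrite divr_ge0// ltW.
have hlt : h < d by rewrite /h ltr_pdivrMr// mulrC -ltr_pdivrMr// truncnS_gt.
have hK : K%:R * h = t by rewrite mulrC mulfVK// gt_eqF.
(* For large m all the sums are close to the coarse sum with K terms. *)
exists (\sum_(0 <= j < K) h *: u (j%:R * h)).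
suff H m j : (j <= K)%N ->
    `|riemann_sum m (j%:R * h) - \sum_(0 <= j < j) h *: u (j%:R * h)| <=
      j%:R * (h * e' + (e' + B) / m.+1%:R).
  suff : \forall m \near \oo, ball (\sum_(0 <= j < K) h *: u (j%:R * h)) e (riemann_sum m t) by [].
  near=> m; rewrite -ball_normE /ball_/= distrC.
  have := H m K (leqnn _); rewrite hK; move=> /le_lt_trans; apply.
  rewrite mulrDr mulrA hK mulrA.
  have : K%:R * (e' + B) / m.+1%:R <= e / 4.
    by near: m; apply: near_invS_le; lra.
  have := e'E;   move: (K%:R * (e' + B) / m.+1%:R) => Q; lra.
elim: j => [_|j IH jK].
  by rewrite !mul0r /riemann_sum mul0r truncn0 !big_geq// subrr normr0.
rewrite big_nat_recr//=.
have jh : j.+1%:R * h <= t by rewrite -hK ler_wpM2r// ler_nat.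
have jj : j.+1%:R * h = j%:R * h + h by rewrite -natr1 mulrDl mul1r.
have j0 : 0 <= j%:R * h by rewrite mulr_ge0.
have := @riemann_sum_increment m (j%:R * h) (j.+1%:R * h) e' (u (j%:R * h))
  ltac:(rewrite j0/= jj; lra) (ltW e'0).
rewrite {3 4}jj [_ + h - _]addrC addKr => /(_ _)/wrap[|].
  move=> r rj; apply: hd => //; try lra.
  by rewrite ger0_norm; lra.
set x := riemann_sum _ _; set y := riemann_sum _ _; set z := \sum_(_ <= _ < _) _; set w := h *: _.
move=> H1; have H2 := IH (ltnW jK).
have -> : x - (z + w) = (x - y - w) + (y - z).
  by rewrite [RHS]addrACA subrK opprD [- z - w]addrC.
apply: (le_trans (ler_normD _ _)); rewrite -natr1 mulrDl mul1r addrC.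
apply: lerD => //; apply: (le_trans H1); rewrite lerD2l ler_pM2r ?invr_gt0// lerD2l.
by apply: hB; lra.
Unshelve. all: by end_near. Qed.

Lemma primitive_exists : exists U : R -> X,
  [/\ U 0 = 0, cont0y U & forall s : R, 0 <= s -> rderive U s (u s)].
Proof.
pose U t := lim (riemann_sum ^~ t @ \oo).
have incr s t e v : 0 <= s <= t -> 0 <= e ->
    (forall r, s <= r <= t -> `|u r - v| <= e) ->
    `|U t - U s - (t - s) *: v| <= (t - s) * e.
  move=> st e0 hv; apply/ler_addgt0Pr => k k0.
  have cvs : riemann_sum ^~ s @ \oo --> U s by apply: riemann_sum_cvg; lra.
  have cvt : riemann_sum ^~ t @ \oo --> U t by apply: riemann_sum_cvg; lra.
  near \oo => m.
  have H1 := riemann_sum_increment m st e0 hv.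
  have H2 : `|U t - riemann_sum m t| <= k / 3.
    by near: m; move/cvgrPdist_le: cvt; apply; lra.
  have H3 : `|U s - riemann_sum m s| <= k / 3.
    by near: m; move/cvgrPdist_le: cvs; apply; lra.
  have H4 : (e + `|v|) / m.+1%:R <= k / 3.
    by near: m; apply: near_invS_le; lra.
  have -> : U t - U s - (t - s) *: v = (U t - riemann_sum m t) - (U s - riemann_sum m s)
      + (riemann_sum m t - riemann_sum m s - (t - s) *: v).
    by rewrite opprB [RHS](AC (2*2*3) (1*4*7*(2*5)*(3*6)))/= addNr subrr !addr0.
  apply: (le_trans (ler_normD _ _)); have := ler_normB (U t - riemann_sum m t) (U s - riemann_sum m s).
  by move: H1 H4; move: (_ / m.+1%:R) => Q; lra.
exists U; split.
- by rewrite /U (_ : riemann_sum^~ 0 = cst 0) ?lim_cst//; apply/funext => m;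
    rewrite /riemann_sum mul0r truncn0 big_geq.
- move=> s e s0 e0.
  have [B B0 hB] := cont0y_bounded (s + 1) cu.
  have lip p q : 0 <= p <= q -> q <= s + 1 -> `|U q - U p| <= (q - p) * B.
    move=> pq qs; have := @incr p q B 0 pq B0; rewrite scaler0 subr0; apply.
    by move=> r rpq; rewrite subr0; apply: hB; lra.
  exists (Num.min 1 (e / (B + 1))) => [|r r0].
    by rewrite lt_min ltr01 divr_gt0//; lra.
  rewrite lt_min => /andP[rs1]; rewrite ltr_pdivlMr ?ltr_pwDr// => rse.
  suff : `|U r - U s| <= `|r - s| * B by have := normr_ge0 (r - s); lra.
  move: rs1; rewrite ltr_norml => rs1.
  have [rs|sr] := leP r s.
    by rewrite distrC [`|r - s|]distrC (ger0_norm (x := s - r)) ?lip//; lra.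
  by rewrite (ger0_norm (x := r - s)) ?lip//; lra.
- move=> s s0 e e0; have [d d0 hd] := cu s0 e0; exists d => // h hh.
  rewrite (_ : h *: u s = (s + h - s) *: u s); last by rewrite addrC addKr.
  rewrite [in leRHS](_ : h = s + h - s); last by rewrite addrC addKr.
  apply: incr; [lra|lra|]; move=> r rr; apply: hd; first lra.
  by rewrite ger0_norm; lra.
Unshelve. all: by end_near. Qed.

End Primitive.

(** * Bounded linear maps and one-sided derivatives *)

Section LinearMaps.
Variables (R : realType) (X Y : normedModType R) (S : X -> Y).
Hypothesis linS : linear S.

Lemma linD x y : S (x + y) = S x + S y.
Proof. by rewrite -[x]scale1r linS !scale1r. Qed.

Lemma lin0 : S 0 = 0.
Proof. by apply: (@addIr _ (S 0)); rewrite -linD !add0r. Qed.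

Lemma linZ k x : S (k *: x) = k *: S x.
Proof. by rewrite -[k *: x]addr0 linS lin0 addr0. Qed.

Lemma linB x y : S (x - y) = S x - S y.
Proof. by rewrite -scaleN1r linD linZ scaleN1r. Qed.

Lemma lin_unit_ball (c : R) : (forall x, `|x| <= 1 -> `|S x| <= c) ->
  forall x, `|S x| <= c * `|x|.
Proof.
move=> hc x; have [->|x0] := eqVneq x 0; first by rewrite lin0 !normr0 mulr0.
have nx0 : 0 < `|x| by rewrite normr_gt0.
have := hc (`|x|^-1 *: x).
rewrite linZ !normrZ ger0_norm ?invr_ge0// mulVf ?gt_eqF// => /(_ (lexx _)).
by rewrite ler_pdivrMl// mulrC.
Qed.

End LinearMaps.

Section OperatorNorm.
Variables (R : realType) (X : normedModType R) (S : X -> X).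
Hypothesis linS : linear S.

Lemma op_norm_leP (c : R) : 0 <= c ->
  (op_norm S <= c%:E)%E <-> forall x, `|S x| <= c * `|x|.
Proof.
move=> c0; split=> [Sc|Sc].
  apply: lin_unit_ball => // x x1.
  rewrite -lee_fin; apply: le_trans Sc; apply: ereal_sup_ubound.
  by exists x.
apply: ge_ereal_sup => _ [x /= x1 <-]; rewrite lee_fin.
by apply: (le_trans (Sc x)); rewrite ler_piMr.
Qed.

Lemma op_norm_lty : (op_norm S < +oo)%E ->
  exists2 c : R, 0 <= c & forall x, `|S x| <= c * `|x|.
Proof.
have pos : (0 <= op_norm S)%E.
  by apply: ereal_sup_ubound; exists 0; rewrite /= ?normr0 ?ler01// lin0 ?normr0.
move: pos; case E : (op_norm S) => [c| |]//; rewrite lee_fin => c0 _.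
by exists c => //; apply/op_norm_leP => //; rewrite E.
Qed.

End OperatorNorm.

Section RightDerivative.
Variables (R : realType) (X Y : normedModType R).
Implicit Types u v : R -> X.

Lemma cont0yD u v : cont0y u -> cont0y v -> cont0y (fun s => u s + v s).
Proof.
move=> cu cv s e s0 e0; have e20 : 0 < e / 2 by lra.
have [d d0 hd] := cu s _ s0 e20; have [d' d'0 hd'] := cv s _ s0 e20.
exists (Num.min d d') => [|r r0]; first by rewrite lt_min d0.
rewrite lt_min => /andP[rd rd']; rewrite opprD addrACA.
by apply: (le_trans (ler_normD _ _)); have := hd r r0 rd; have := hd' r r0 rd'; lra.
Qed.

Lemma rderiveD u v s y z : rderive u s y -> rderive v s z ->
  rderive (fun s => u s + v s) s (y + z).
Proof.
move=> du dv e e0; have e20 : 0 < e / 2 by lra.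
have [d d0 hd] := du _ e20; have [d' d'0 hd'] := dv _ e20.
exists (Num.min d d') => [|h]; first by rewrite lt_min d0.
rewrite lt_min => /andP[h0 /andP[rd rd']].
rewrite scalerDr !opprD [X in `|X|](AC (2*2*2) ((1*3*5)*(2*4*6)))/=.
apply: (le_trans (ler_normD _ _)).
by have := hd h ltac:(lra); have := hd' h ltac:(lra); lra.
Qed.

Lemma cont0y_shift u r : 0 <= r -> cont0y u -> cont0y (fun s => u (s + r)).
Proof.
move=> r0 cu s e s0 e0; have [d d0 hd] := cu (s + r) e ltac:(lra) e0.
exists d => // q q0 qs; apply: hd; first lra.
by rewrite (_ : q + r - _ = q - s)//; lra.
Qed.

Lemma rderive_shift u r s z : rderive u (s + r) z -> rderive (fun s => u (s + r)) s z.
Proof.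
move=> du e e0; have [d d0 hd] := du e e0; exists d => // h hh.
by rewrite [s + h + r]addrAC; exact: hd.
Qed.

Lemma cont0y_cst (x : X) : cont0y (fun=> x).
Proof. by move=> s e s0 e0; exists 1 => // r _ _; rewrite subrr normr0 ltW. Qed.

Lemma rderive_cst (x : X) s : rderive (fun=> x) s 0.
Proof.
move=> e e0; exists 1 => // h /andP[h0 _].
by rewrite scaler0 subrr subr0 normr0 mulr_ge0 ?ltW.
Qed.

Variables (S : X -> Y) (c : R).
Hypotheses (linS : linear S) (c0 : 0 <= c) (Sc : forall x, `|S x| <= c * `|x|).

Let c1 : 0 < c + 1. Proof. by have := c0; lra. Qed.

Lemma cont0y_lin u : cont0y u -> cont0y (fun s => S (u s)).
Proof.
move=> cu s e s0 e0.
have e'0 : 0 < e / (c + 1) by exact: divr_gt0.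
have [d d0 hd] := cu s _ s0 e'0; exists d => // r r0 rs.
rewrite -(linB linS); apply: (le_trans (Sc _)).
have := hd r r0 rs; rewrite ler_pdivlMr//.
by have := normr_ge0 (u r - u s); lra.
Qed.

Lemma rderive_lin u s z : rderive u s z -> rderive (fun s => S (u s)) s (S z).
Proof.
move=> du e e0.
have e'0 : 0 < e / (c + 1) by exact: divr_gt0.
have [d d0 hd] := du _ e'0; exists d => // h hh.
rewrite -(linZ linS) -!(linB linS); apply: (le_trans (Sc _)).
have := hd h hh; rewrite mulrA ler_pdivlMr//.
by have := normr_ge0 (u (s + h) - u s - h *: z); lra.
Qed.

End RightDerivative.

Lemma rderiveN (R : realType) (X : normedModType R) (u : R -> X) s z :
  rderive u s z -> rderive (fun s => - u s) s (- z).
Proof.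
apply: (@rderive_lin _ _ _ -%R 1) => // [k x y|x]; last by rewrite normrN mul1r.
by rewrite opprD scalerN.
Qed.

Lemma cont0yN (R : realType) (X : normedModType R) (u : R -> X) :
  cont0y u -> cont0y (fun s => - u s).
Proof.
apply: (@cont0y_lin _ _ _ -%R 1) => // [k x y|x]; last by rewrite normrN mul1r.
by rewrite opprD scalerN.
Qed.

(** * Strongly continuous semigroups *)

Section Semigroup.
Variables (R : realType) (X : completeNormedModType R) (T : R -> X -> X).
Hypothesis sgT : c0_semigroup T.

Lemma orbit_cont0y x : cont0y (T ^~ x).
Proof. by apply/cont0yP; exact: c0_continuous. Qed.

(** Orbits are bounded on [0, 1], hence so is the norm of T there, by
Banach-Steinhaus; the semigroup law then multiplies this bound at each unit
of time. *)
Lemma semigroup_bound : exists M w : R, [/\ 1 <= M, 0 <= w &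
  forall t x, 0 <= t -> `|T t x| <= M * expR (t * w) * `|x|].
Proof.
pose F : set (X -> X) := [set T t | t in `[0, 1]].
have /(_ 1)[M0 hM0] : uniform_bounded F.
  apply: Banach_Steinhauss => [_ [t /= + <-]|x].
    rewrite in_itv/= => /andP[t0 _].
    have linT := c0_linear sgT t0; split => // r.
    have [c c0 hc] := op_norm_lty linT (c0_bounded sgT t0).
    by exists (c * r) => x xr; apply: (le_trans (hc x)); rewrite ler_wpM2l.
  have [K K0 hK] := cont0y_bounded 1 (orbit_cont0y x).
  by exists K => _ [t /= + <-]; rewrite in_itv => /hK.
pose M := Num.max 1 M0.
have M1 : 1 <= M by rewrite le_max lexx.
have TM t x : 0 <= t <= 1 -> `|T t x| <= M * `|x|.
  move=> t01; apply: lin_unit_ball => [|y y1].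
    by apply: (c0_linear sgT); lra.
  by rewrite le_max hM0 ?orbT//; exists t => //=; rewrite in_itv.
(* M ^ n = exp (n ln M). *)
exists M, (ln M); split => //; first exact: ln_ge0.
move=> t x t0; have /andP[n1 n2] := truncn_itv t0; set n := Num.truncn t in n1 n2.
have lnM0 : 0 <= ln M by exact: ln_ge0.
suff H k s : 0 <= s <= 1 -> `|T (k%:R + s) x| <= M ^+ k.+1 * `|x|.
  have := H n (t - n%:R); rewrite [n%:R + _]addrC subrK => /(_ _)/le_trans; apply.
    by rewrite -natr1 in n2; lra.
  rewrite ler_wpM2r// exprS ler_wpM2l//; first lra.
  rewrite -[M in M ^+ _]lnK ?posrE; last lra.
  by rewrite -expRM_natl ler_expR ler_wpM2r.
elim: k s => [s s01|k IH s s01]; first by rewrite add0r expr1 TM.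
rewrite -natr1 -addrA [1 + s]addrC addrA (addrC _ 1) (c0_D sgT) ?ler01//; last first.
  by have := ler0n R k; lra.
apply: (le_trans (TM _ _ _)); first by rewrite lexx ler01.
by rewrite exprS -mulrA ler_wpM2l ?IH//; lra.
Qed.

Lemma generatorP x y : generator T (x, y) <-> rderive (T ^~ x) 0 y.
Proof.
have E h : h != 0 -> h *: (y - h^-1 *: (T h x - x)) = - (T (0 + h) x - T 0 x - h *: y).
  move=> h0; rewrite scalerBr scalerA divff// scale1r add0r (c0_0 sgT).
  by rewrite [RHS]opprB.
split.
  move=> /cvgrPdist_le gen e e0; have := gen e e0.
  rewrite near_withinE => /nbhs_ballP[d /= d0 hd].
  exists d => // h /andP[h0 hd'].
  rewrite -normrN -E ?gt_eqF// normrZ gtr0_norm// ler_wpM2l//; first exact: ltW.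
  by apply: hd => //; rewrite /ball/= sub0r normrN gtr0_norm.
move=> dT; apply/cvgrPdist_le => e e0; have [d d0 hd] := dT e e0.
rewrite near_withinE; apply/nbhs_ballP; exists d => //= h.
rewrite /ball/= sub0r normrN => + h0.
rewrite gtr0_norm// => hd'.
have := hd h; rewrite h0 hd' => /(_ isT).
by rewrite -normrN -E ?gt_eqF// normrZ gtr0_norm// ler_pM2l.
Qed.

Lemma generator_orbit x y s : 0 <= s -> generator T (x, y) ->
  generator T (T s x, T s y) /\ rderive (T ^~ x) s (T s y).
Proof.
move=> s0 /generatorP xy.
have linT := c0_linear sgT s0.
have [c c0 hc] := op_norm_lty linT (c0_bounded sgT s0).
have H : rderive (fun r => T s (T r x)) 0 (T s y) by apply: (rderive_lin linT c0 hc).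
have E r : 0 <= r -> T s (T r x) = T (s + r) x by move=> r0; rewrite (c0_D sgT).
split.
  apply/generatorP => e e0; have [d d0 hd] := H e e0; exists d => // h hh.
  have := hd h hh; rewrite !E ?addr0//; last lra.
  by rewrite add0r -!(c0_D sgT) ?addr0 ?(addrC s h) ?add0r//; lra.
move=> e e0; have [d d0 hd] := H e e0; exists d => // h hh.
by have := hd h hh; rewrite !E ?addr0 ?add0r//; lra.
Qed.

(** Along the orbit of x in the domain of the generator the derivative is T r y; hence
the increment is controlled by how far T r y strays from a fixed v. *)
Lemma orbit_increment x y (a b e : R) (v : X) : 0 <= a <= b ->
  generator T (x, y) -> (forall r, a <= r <= b -> `|T r y - v| <= e) ->
  `|T b x - T a x - (b - a) *: v| <= (b - a) * e.
Proof.
move=> ab xy yv; pose f r := T r x - (r - a) *: v.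
have -> : T b x - T a x - (b - a) *: v = f b - f a.
  by rewrite /f subrr scale0r subr0 addrAC.
apply: mean_value => //.
  apply: cont0yD; first exact: orbit_cont0y.
  apply: cont0yN => r k r0 k0.
  exists (k / (`|v| + 1)) => [|r' r'0]; first by rewrite divr_gt0// ltr_wpDl.
  rewrite ltr_pdivlMr ?ltr_wpDl// -scalerBl normrZ => H.
  rewrite (_ : r' - a - (r - a) = r' - r); last by lra.
  by have := normr_ge0 (r' - r); lra.
move=> r rs k k0; have r0 : 0 <= r by lra.
have [_ H] := generator_orbit r0 xy.
have [d d0 hd] := H k k0; exists d => // h hh.
have -> : f (r + h) - f r = (T (r + h) x - T r x - h *: T r y) + h *: (T r y - v).
  rewrite /f (_ : r + h - a = (r - a) + h); last by lra.
  rewrite scalerDl scalerBr !opprD opprK.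
  by rewrite [RHS](AC (3*2) (1*2*5*(3*4)))/= [LHS](AC ((1*2)*2) (1*4*3*(2*5)))/= !addNr.
apply: (le_trans (ler_normD _ _)); rewrite normrZ gtr0_norm; last by lra.
rewrite mulrDr addrC; apply: lerD; last exact: hd.
by rewrite ler_wpM2l ?yv//; lra.
Qed.

(** The means of an orbit over [0, h] belong to the domain and tend to x as h tends
to 0. With U a primitive of the orbit, T(r) U(t) and U(t + r) - U(r) have the same
derivative in t, which exhibits the difference quotients of T at U(h). *)
Lemma generator_dense x (e : R) : 0 < e ->
  exists y z, generator T (y, z) /\ `|x - y| <= e.
Proof.
move=> e0.
have [U [U0 cU dU]] := primitive_exists (orbit_cont0y x).
have TU r t : 0 <= r -> 0 <= t -> T r (U t) = U (t + r) - U r.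
  move=> r0 t0.
  have linT := c0_linear sgT r0.
  have [c c0 hc] := op_norm_lty linT (c0_bounded sgT r0).
  pose f t := T r (U t) + (- U (t + r) + U r).
  have : f t = f 0.
    apply: cont0y_rderive_eq0 => //.
      apply: cont0yD; first exact: (cont0y_lin linT c0 hc).
      by apply: cont0yD; [exact: cont0yN (cont0y_shift r0 cU) | exact: cont0y_cst].
    move=> s s0; rewrite -(subrr (T (s + r) x)) -[- _]addr0.
    apply: rderiveD.
      by rewrite addrC (c0_D sgT)//; apply: (rderive_lin linT c0 hc); exact: dU.
    apply: rderiveD; last exact: rderive_cst.
    by apply: rderiveN; apply: rderive_shift; apply: dU; lra.
  rewrite /f U0 (lin0 linT) add0r add0r addNr => /eqP.
  by rewrite addr_eq0 opprD opprK => /eqP.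
have [d d0 hd] := dU 0 (lexx _) e e0.
pose h := d / 2; have h0 : 0 < h by rewrite /h; lra.
exists (h^-1 *: U h), (h^-1 *: (T h x - x)); split.
  apply/generatorP.
  have H : rderive (T ^~ (U h)) 0 (T h x - x).
    have H1 : rderive (fun s => U (s + h) + - U s) 0 (T h x - x).
      apply: rderiveD; first by apply: rderive_shift; rewrite add0r; apply: dU; lra.
      by apply: rderiveN; rewrite -[x in rderive _ _ x](c0_0 sgT); apply: dU.
    move=> k k0; have [d' d'0 hd'] := H1 k k0; exists d' => // r rr.
    by have := hd' r rr; rewrite !TU ?(addrC h) ?subr0//; lra.
  have linZ' : linear (fun v : X => h^-1 *: v).
    by move=> k u v; rewrite scalerDr !scalerA mulrC.
  have := rderive_lin linZ' (c := h^-1) _ _ H.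
  move=> /(_ _ _)/wrap[]; first by rewrite invr_ge0 ltW.
    by move=> v; rewrite normrZ gtr0_norm ?invr_gt0.
  move=> H2 k k0; have [d' d'0 hd'] := H2 k k0; exists d' => // r rr.
  by have := hd' r rr; rewrite !(linZ (c0_linear sgT _))//; lra.
have := hd h; rewrite add0r U0 subr0 (c0_0 sgT) => /(_ _)/wrap[]; first by rewrite /h; lra.
move=> H; rewrite -(ler_pM2l h0) -{1}(gtr0_norm h0) -normrZ scalerBr scalerA.
by rewrite divff ?gt_eqF// scale1r distrC.
Qed.

(** If u solves u' = A u + f with |f| <= c, then s |-> T(t - s) u(s) has derivative
T(t - s) f(s), of norm at most K c. For c = 0 this is uniqueness for the Cauchy
problem. *)
Lemma duhamel (u : R -> X) (t K c : R) : 0 <= t -> 0 <= K -> cont0y u ->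
  (forall s x, 0 <= s <= t -> `|T s x| <= K * `|x|) ->
  (forall s, 0 <= s < t -> exists y z,
     [/\ rderive u s z, generator T (u s, y) & `|z - y| <= c]) ->
  `|u t - T t (u 0)| <= t * (K * c).
Proof.
move=> t0 K0 cu TK du.
(* The truncation at 0 makes s |-> T (t - s) (u s) continuous on the half-line. *)
pose p s := Num.max 0 (t - s).
have p0 s : 0 <= p s by rewrite le_max lexx.
have pt s : 0 <= s -> p s <= t by move=> s0; rewrite ge_max t0; lra.
pose f s := T (p s) (u s).
have cf : cont0y f.
  move=> s e s0 e0; have e20 : 0 < e / 2 by lra.
  have e'0 : 0 < e / (2 * (K + 1)) by rewrite divr_gt0//; lra.
  have [d d0 hd] := orbit_cont0y (u s) (p0 s) e20.
  have [d' d'0 hd'] := cu s _ s0 e'0.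
  exists (Num.min d d') => [|r r0]; first by rewrite lt_min d0.
  rewrite lt_min => /andP[rd rd'].
  have -> : f r - f s = T (p r) (u r - u s) + (T (p r) (u s) - T (p s) (u s)).
    by rewrite (linB (c0_linear sgT _))// addrA subrK.
  apply: (le_trans (ler_normD _ _)).
  have H1 : `|T (p r) (u s) - T (p s) (u s)| <= e / 2.
    apply: hd => //; apply: le_lt_trans rd.
    rewrite /p; case: (leP 0 (t - r)) => tr; case: (leP 0 (t - s)) => ts.
    - by rewrite (_ : t - r - (t - s) = - (r - s)) ?normrN//; lra.
    - by rewrite subr0 ger0_norm ?ler0_norm; lra.
    - by rewrite sub0r normrN ger0_norm ?ger0_norm; lra.
    - by rewrite subrr normr0.
  have H2 : `|T (p r) (u r - u s)| <= e / 2.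
    apply: (le_trans (TK _ _ _)); first by rewrite p0 pt.
    have := hd' r r0 rd'; rewrite ler_pdivlMr; last lra.
    by have := normr_ge0 (u r - u s); lra.
  lra.
have -> : u t - T t (u 0) = f t - f 0.
  rewrite /f /p subrr maxxx subr0 (c0_0 sgT).
  by have -> : Num.max 0 t = t by apply/max_idPr.
rewrite -[t in leRHS]subr0; apply: (@mean_value _ _ f 0 t) => //.
  by rewrite lexx.
move=> s st e e0; have [y [z [dz gy zy]]] := du s st.
have e'0 : 0 < e / (2 * (K + 1)) by rewrite divr_gt0//; lra.
have e'E : (2 * (K + 1)) * (e / (2 * (K + 1))) = e by field; lra.
move: (e / _) e'0 e'E => e' e'0 e'E.
have [d d0 hd] := dz _ e'0.
have [d' d'0 hd'] := iffLR (generatorP _ _) gy _ e'0.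
exists (Num.min (t - s) (Num.min d d')) => [|h].
  by rewrite !lt_min d0 d'0 !andbT; lra.
rewrite !lt_min => /andP[h0 /andP[hts /andP[hhd hhd']]].
have ps : p s = p (s + h) + h.
  by rewrite /p !(max_idPr _); lra.
rewrite /f ps (c0_D sgT)//; last exact: ltW.
rewrite -(linB (c0_linear sgT _))//.
apply: (le_trans (TK _ _ _)); first by rewrite p0 pt//; lra.
have H1 := hd h ltac:(lra); have H2 := hd' h ltac:(lra).
rewrite add0r (c0_0 sgT) in H2.
have : `|u (s + h) - T h (u s)| <= h * (c + 2 * e').
  have -> : u (s + h) - T h (u s) = (u (s + h) - u s - h *: z)
      - (T h (u s) - u s - h *: y) + h *: (z - y).
    rewrite scalerBr !opprB [RHS](AC (3*(1*2)*2) ((1*6)*(2*5)*(3*7)*(4*8)))/=.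
    by rewrite !addNr subrr !addr0.
  apply: (le_trans (ler_normD _ _)); rewrite normrZ gtr0_norm//.
  have := ler_normB (u (s + h) - u s - h *: z) (T h (u s) - u s - h *: y).
  by have : h * `|z - y| <= h * c by [rewrite ler_pM2l]; lra.
move=> /(ler_wpM2l K0) /le_trans; apply.
rewrite mulrCA ler_pM2l//; lra.
Qed.

End Semigroup.

(** * The Chernoff product formula *)

Lemma lin_iter (R : realType) (X : normedModType R) (S : X -> X) n :
  linear S -> linear (iter n S).
Proof. by move=> linS; elim: n => // n IH k u v; rewrite !iterS IH linS. Qed.

Lemma norm_telescope (R : realType) (X : normedModType R) (a : nat -> X)
    (d : R) n :
  (forall k, (k < n)%N -> `|a k - a k.+1| <= d) -> `|a 0%N - a n| <= n%:R * d.
Proof.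
elim: n => [|n IH] H; first by rewrite subrr normr0 mul0r.
rewrite -natr1 mulrDl mul1r; have := H n (ltnSn n); have := IH (fun k kn => H k (ltnW kn)).
by have := ler_distD (a n) (a 0%N) (a n.+1); lra.
Qed.

(** Stability and consistency give convergence: a sequence v that S follows with
defect d at each step is followed by the powers of S with error n C d. *)
Lemma iter_telescope (R : realType) (X : normedModType R) (S : X -> X)
    (C d : R) (v : nat -> X) n :
  linear S -> (forall i x, (i <= n)%N -> `|iter i S x| <= C * `|x|) -> 0 <= C ->
  (forall k, (k < n)%N -> `|S (v k) - v k.+1| <= d) ->
  `|iter n S (v 0%N) - v n| <= n%:R * (C * d).
Proof.
move=> linS SC C0 Sd.
pose a k := iter (n - k) S (v k).
have -> : iter n S (v 0%N) - v n = a 0%N - a n by rewrite /a subn0 subnn.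
apply: norm_telescope => k kn.
rewrite /a -(subnSK kn) iterSr -(linB (lin_iter _ linS)).
apply: (le_trans (SC _ _ _)); first exact: leq_subr.
by rewrite ler_wpM2l// Sd.
Qed.

Lemma near_below (P : nat -> nat -> Prop) K :
  (forall j, \forall n \near \oo, P j n) ->
  \forall n \near \oo, forall j, (j < K)%N -> P j n.
Proof.
move=> HP; elim: K => [|K IH]; first by apply: nearW.
near=> n => j; rewrite ltnS leq_eqVlt => /predU1P[->|]; first by near: n.
by move: j; near: n.
Unshelve. all: by end_near. Qed.

Lemma closure_norm (R : realType) (X : normedModType R) (B : operator X) x y e :
  closure B (x, y) -> 0 < e ->
  exists x' y', [/\ B (x', y'), `|x - x'| <= e & `|y - y'| <= e].
Proof.
move=> clB e0.
have [[x' y'] [Bq]] := clB _ (nbhsx_ballx (x, y) e e0).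
rewrite -ball_normE /ball_/= => /ltW.
by rewrite prod_normE/= ge_max => /andP[]; exists x', y'.
Qed.

(** One step of a linear map S along the segment from y to y', from parameter b to
parameter b + c, split into the consistency defects at the two end points with
respect to the velocity z, the defect of the chord y' - y with respect to d z, and
the mismatch between the step h and c d. *)
Lemma interpolation_defect (R : realType) (X : normedModType R)
    (b c d h : R) (y y' Sy Sy' z : X) :
  Sy + b *: (Sy' - Sy) - (y + (b + c) *: (y' - y)) =
  (1 - b) *: (Sy - y - h *: z) + b *: (Sy' - y' - h *: z)
    - c *: (y' - y - d *: z) + (h - c * d) *: z.
Proof.
pose p := Sy - y; pose r := y' - y; pose s := Sy' - y' - p.
have -> : Sy = y + p by rewrite /p addrC subrK.
have -> : Sy' = y' + (p + s) by rewrite /s [p + _]addrC subrK addrC subrK.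
have -> : y' = y + r by rewrite /r addrC subrK.
clearbody p r s.
have -> : y + r + (p + s) - (y + p) = r + s.
  by rewrite opprD [LHS](AC (2*2*2) (1*5*(3*6)*2*4))/= !subrr !add0r.
have -> : y + r - y = r by rewrite addrC addKr.
have -> : y + r + (p + s) - (y + r) = p + s by rewrite addrC addKr.
have -> : y + p - y = p by rewrite addrC addKr.
have -> : p + s - h *: z = (p - h *: z) + s by rewrite addrAC.
rewrite [in RHS](scalerDr b) addrA -[in RHS]scalerDl subrK scale1r.
rewrite (scalerDr b) (scalerDl r) (scalerDr c) scalerBl scalerN scalerA !opprD opprK.
rewrite [LHS](AC (2*2*(1*2)) ((1*5)*(3*6)*(2*4*7)))/= !subrr !add0r.
by rewrite [RHS](AC (2*1*2*2) ((2*6)*(5*7)*(1*3*4)))/= !(addNr, subrr) !add0r.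
Qed.

(** The q steps of length h that cover a time d, up to a rounding error of at most h,
lead along the segment from y to y' when its slope is close to a vector z that S
follows infinitesimally at both ends. The segment is traversed in q equal steps,
so that it ends exactly at y'. *)
Lemma block_estimate (R : realType) (X : normedModType R) (S : X -> X)
    (C e h d : R) (y y' z : X) q :
  linear S -> (forall i x, (i <= q)%N -> `|iter i S x| <= C * `|x|) -> 0 <= C ->
  0 <= e -> 0 <= h <= d -> `|d - q%:R * h| <= h -> h * `|z| <= e * d -> (0 < q)%N ->
  `|S y - y - h *: z| <= h * e -> `|S y' - y' - h *: z| <= h * e ->
  `|y' - y - d *: z| <= d * e ->
  `|iter q S y - y'| <= C * (4 * (e * d)).
Proof.
move=> linS SC C0 e0 hd dqh hz q0 hy hy' yy.
have Q0 : 0 < (q%:R : R) by rewrite ltr0n.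
pose v k := y + (k%:R / q%:R) *: (y' - y).
have [<- <-] : v 0%N = y /\ v q = y'.
  by rewrite /v mul0r scale0r addr0 divff ?gt_eqF// scale1r addrC subrK.
apply: (@le_trans _ _ (q%:R * (C * ((q%:R * h * e + d * e + h * `|z|) / q%:R)))).
  apply: iter_telescope => // k kq.
  set b : R := k%:R / q%:R.
  have b0 : 0 <= b by rewrite divr_ge0.
  have b1 : b <= 1 by rewrite ler_pdivrMr// mul1r ler_nat ltnW.
  have -> : S (v k) - v k.+1 = (1 - b) *: (S y - y - h *: z)
      + b *: (S y' - y' - h *: z) - q%:R^-1 *: (y' - y - d *: z)
      + (q%:R^-1 * (q%:R * h - d)) *: z.
    rewrite /v -natr1 mulrDl mul1r -/b (linD linS) (linZ linS) (linB linS).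
    rewrite mulrBr mulKf ?gt_eqF//; exact: interpolation_defect.
  clearbody b.
  apply: (le_trans (ler_normD _ _)).
  apply: (@le_trans _ _ (((1 - b) * (h * e) + b * (h * e) + q%:R^-1 * (d * e))
     + q%:R^-1 * h * `|z|)).
    apply: lerD; last first.
      rewrite normrZ ler_wpM2r// normrM gtr0_norm ?invr_gt0//.
      by apply: ler_wpM2l; [rewrite invr_ge0 ltW | rewrite distrC].
    apply: (le_trans (ler_normB _ _)); apply: lerD; last first.
      by rewrite normrZ gtr0_norm ?invr_gt0// ler_pM2l ?invr_gt0.
    apply: (le_trans (ler_normD _ _)); rewrite !normrZ.
    have b1' : 0 <= 1 - b by rewrite subr_ge0.
    by rewrite (ger0_norm b0) (ger0_norm b1'); apply: lerD; apply: ler_wpM2l.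
  by rewrite le_eqVlt; apply/orP; left; apply/eqP; field; rewrite gt_eqF.
rewrite mulrCA; apply: ler_wpM2l => //; rewrite mulrC divfK ?gt_eqF//.
have : q%:R * h <= 2 * d by move: dqh; rewrite ler_distl; lra.
by move=> /(ler_wpM2r e0); lra.
Qed.

Section Chernoff.
Variables (R : realType) (X : completeNormedModType R).
Variables (F : R -> X -> X) (M w : R) (B : operator X) (T : R -> X -> X).
Hypothesis linF : forall h, 0 <= h -> linear (F h).
Hypothesis F0 : forall x, F 0 x = x.
Hypotheses (M1 : 1 <= M) (w0 : 0 <= w).
Hypothesis stabF : forall h k x, 0 <= h ->
  `|iter k (F h) x| <= M * expR (k%:R * h * w) * `|x|.
Hypothesis consF : forall y z, B (y, z) -> rderive (F ^~ y) 0 z.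
Hypotheses (sgT : c0_semigroup T) (genT : closure B = generator T).

Lemma stable_upto t n k x : 0 <= t -> (0 < n)%N -> (k <= n)%N ->
  `|iter k (F (t / n%:R)) x| <= M * expR (t * w) * `|x|.
Proof.
move=> t0 n0 kn; have N0 : 0 < (n%:R : R) by rewrite ltr0n.
have M0 : 0 <= M by have := M1; lra.
apply: (le_trans (stabF _ _ _)); first by rewrite divr_ge0// ltW.
rewrite ler_wpM2r// ler_wpM2l// ler_expR ler_wpM2r ?w0//.
by rewrite mulrCA ler_piMr// ler_pdivrMr// mul1r ler_nat.
Qed.

(** The nodes s_j = j d are fixed first, fine enough that T(s) y varies little between
two of them, and the core vectors q_j approximate (T(s_j) x, T(s_j) y); only then
does n tend to infinity. The steps are distributed over the K blocks according to
N_j = j n / K rounded down, so that the first block starts at 0 and the last one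
ends at n for every n. *)
Lemma chernoff_generator t x y e : 0 < t -> generator T (x, y) -> 0 < e ->
  \forall n \near \oo, `|iter n (F (t / n%:R)) x - T t x| <= e.
Proof.
move=> t0 xy e0.
set C := M * expR (t * w).
have C1 : 1 <= C.
  have m1 := M1; have : 1 <= expR (t * w) by rewrite -expR0 ler_expR mulr_ge0 ?w0// ltW.
  move=> E1; rewrite -[1]mulr1; apply: ler_pM => //; exact: ler01.
have SU n k v := @stable_upto t n k v (ltW t0).
rewrite -/C in SU; clearbody C.
have C0 : 0 < C by lra.
have [e1 e10 e1E] : exists2 e1 : R, 0 < e1 & 6 * C ^+ 2 * e1 * t = e.
  (* The blocks contribute 4 C^2 e1 t, and replacing the end points of the orbit by
     core vectors contributes at most 2 C e1 d. *)
  exists (e / (6 * C ^+ 2 * t)); first by rewrite divr_gt0 ?(mulr_gt0, exprn_gt0).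
  by field; rewrite !gt_eqF.
have e30 : 0 < e1 / 3 by lra.
have [dl dl0 hdl] := cont0y_unif (ltW t0) (orbit_cont0y sgT y) e30.
pose K := (Num.truncn (t / dl)).+1; pose d := t / K%:R.
have K0 : 0 < (K%:R : R) by rewrite ltr0n.
have d0 : 0 < d by rewrite divr_gt0.
have ddl : d < dl by rewrite /d ltr_pdivrMr// mulrC -ltr_pdivrMr// truncnS_gt.
have Kd : K%:R * d = t by rewrite mulrC divfK// gt_eqF.
have dt : d <= t by rewrite -Kd ler_peMl ?ler1n// ltW.
clearbody d.
pose s (j : nat) : R := j%:R * d.
have s0 j : 0 <= s j by rewrite mulr_ge0// ltW.
have sS j : s j.+1 = s j + d by rewrite /s -natr1 mulrDl mul1r.
have st j : (j <= K)%N -> s j <= t by move=> jK; rewrite -Kd ler_pM2r// ler_nat.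
(* A mesh-independent accuracy is enough for the images, but the nodes must be
   accurate to o(d), since the slope of the polygon divides by d. *)
have ed0 : 0 < Num.min (e1 * d / 3) (e1 / 3) by rewrite lt_min e30 divr_gt0// mulr_gt0.
have /choice[q hq] : forall j : nat, exists q : X * X, [/\ B q,
    `|T (s j) x - q.1| <= e1 * d / 3 & `|T (s j) y - q.2| <= e1 / 3].
  move=> j; have [+ _] := generator_orbit sgT (s0 j) xy.
  rewrite -genT => /closure_norm/(_ ed0)[y' [z' [Byz]]].
  by rewrite !le_min => /andP[H _] /andP[_ H']; exists (y', z').
have incr j : (j < K)%N -> `|T (s j.+1) x - T (s j) x - d *: T (s j) y| <= d * (e1 / 3).
  move=> jK; have dE : s j.+1 - s j = d by rewrite sS addrC addKr.
  have := @orbit_increment _ _ _ sgT x y (s j) (s j.+1) (e1 / 3) (T (s j) y).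
  rewrite dE; apply=> //; first by rewrite s0 sS; lra.
  move=> r rs; have r0 : 0 <= r by have := s0 j; lra.
  apply: hdl; [by have := st _ jK; lra|by rewrite s0 st// ltnW|].
  by rewrite ger0_norm; move: rs; rewrite sS; lra.
have consq j : \forall n \near \oo,
   `|F (t / n%:R) (q j).1 - (q j).1 - (t / n%:R) *: (q j).2| <= t / n%:R * (e1 / 3).
  have [Bq _ _] := hq j.
  have := consF (y := (q j).1) (z := (q j).2); rewrite -surjective_pairing => /(_ Bq _ e30)[a a0 ha].
  near=> n.
  have n0 : 0 < (n%:R : R) by rewrite ltr0n; near: n; exact: nbhs_infty_gt.
  have := ha (t / n%:R); rewrite add0r F0; apply; rewrite divr_gt0//=.
  rewrite ltr_pdivrMr// mulrC -ltr_pdivrMr//.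
  by near: n; exact: nbhs_infty_gtr.
have small j : \forall n \near \oo, (t / n%:R) * `|T (s j) y| <= e1 * d.
  near=> n.
  have n0 : 0 < (n%:R : R) by rewrite ltr0n; near: n; exact: nbhs_infty_gt.
  rewrite mulrAC ler_pdivrMr// [leRHS]mulrC -ler_pdivrMr ?mulr_gt0//.
  by near: n; exact: nbhs_infty_ger.
have near_consq := near_below K.+1 consq.
have near_small := near_below K small.
near=> n.
have nK : (K <= n)%N by near: n; exact: nbhs_infty_ge.
have n0 : (0 < n)%N by exact: leq_trans nK.
have N0 : 0 < (n%:R : R) by rewrite ltr0n.
have consn : forall j, (j < K.+1)%N ->
   `|F (t / n%:R) (q j).1 - (q j).1 - (t / n%:R) *: (q j).2| <= t / n%:R * (e1 / 3).
  by near: n.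
have smalln : forall j, (j < K)%N -> (t / n%:R) * `|T (s j) y| <= e1 * d.
  by near: n.
set h := t / n%:R in consn smalln *.
have nh : n%:R * h = t by rewrite mulrC divfK// gt_eqF.
have h0 : 0 < h by rewrite divr_gt0.
have linh : linear (F h) by apply: linF; exact: ltW.
have Fh k v : (k <= n)%N -> `|iter k (F h) v| <= C * `|v|.
  by move=> kn; exact: SU.
clearbody h.
pose N (j : nat) := ((j * n) %/ K)%N.
have N0E : N 0%N = 0%N by rewrite /N mul0n div0n.
have NKE : N K = n by rewrite /N mulKn.
have NS j : (N j < N j.+1)%N.
  rewrite /N mulSn [(n + _)%N]addnC.
  apply: (@leq_trans ((j * n + K) %/ K)); last by rewrite leq_div2r// leq_add2l.
  by rewrite divnDr// divnn addn1.
have Nn j : (j <= K)%N -> (N j <= n)%N.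
  by move=> jK; rewrite -[leqRHS]NKE; apply: leq_div2r; rewrite leq_mul2r jK orbT.
have Nh j : (N j)%:R * h <= s j < (N j)%:R * h + h.
  have E : s j * K%:R = (j * n)%:R * h by rewrite /s -mulrA [d * _]mulrC Kd -nh mulrA natrM.
  rewrite -(ler_pM2r K0) -(ltr_pM2r K0) E.
  rewrite (_ : (N j)%:R * h + h = (N j).+1%:R * h); last by rewrite -natr1 mulrDl mul1r.
  rewrite ![_ * h * _]mulrAC -!natrM ler_pM2r// ltr_pM2r// ler_nat ltr_nat.
  by rewrite leq_trunc_div ltn_ceil.
have he0 : 0 < h * e1 by exact: mulr_gt0.
have block j : (j < K)%N ->
    `|iter (N j.+1 - N j) (F h) (q j).1 - (q j.+1).1| <= C * (4 * (e1 * d)).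
  move=> jK.
  have [_ q1 q2] := hq j; have [_ q1' q2'] := hq j.+1.
  have wj : `|T (s j) y - T (s j.+1) y| <= e1 / 3.
    apply: hdl; [by rewrite s0 st// ltnW|by rewrite s0 st|].
    by rewrite sS ltr_norml; lra.
  apply: (@block_estimate _ _ _ C e1 h d _ _ (T (s j) y)) => //.
  - move=> i v ij; apply: Fh; apply: (leq_trans ij).
    by apply: (leq_trans (leq_subr _ _)); exact: Nn.
  - exact: ltW.
  - exact: ltW.
  - by rewrite ltW//= -(ler_pM2l K0) Kd -nh ler_pM2r// ler_nat.
  - have E1 := Nh j; have E2 := Nh j.+1; rewrite sS in E2.
    by rewrite natrB; [rewrite ler_distl; lra | exact: ltnW].
  - exact: smalln.
  - by rewrite subn_gt0.
  - have := consn j (ltnW jK) => H.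
    rewrite (_ : _ - h *: T (s j) y = (F h (q j).1 - (q j).1 - h *: (q j).2)
      - h *: (T (s j) y - (q j).2)).
      apply: (le_trans (ler_normB _ _)); rewrite normrZ gtr0_norm//.
      by have : h * `|T (s j) y - (q j).2| <= h * (e1 / 3) by [rewrite ler_pM2l]; lra.
    by rewrite scalerBr [in RHS]opprB subrKA.
  - have := consn j.+1 jK => H.
    have := ler_distD (T (s j.+1) y) (T (s j) y) (q j.+1).2 => D3.
    rewrite (_ : _ - h *: T (s j) y = (F h (q j.+1).1 - (q j.+1).1 - h *: (q j.+1).2)
      - h *: (T (s j) y - (q j.+1).2)).
      apply: (le_trans (ler_normB _ _)); rewrite normrZ gtr0_norm//.
      have : h * `|T (s j) y - (q j.+1).2| <= h * (2 * (e1 / 3)); last by lra.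
      by rewrite ler_pM2l//; lra.
    by rewrite scalerBr [in RHS]opprB subrKA.
  - have I := incr j jK.
    rewrite (_ : _ - d *: T (s j) y = (T (s j.+1) x - T (s j) x - d *: T (s j) y)
      + (T (s j) x - (q j).1) - (T (s j.+1) x - (q j.+1).1)).
      apply: (le_trans (ler_normB _ _)).
      have := ler_normD (T (s j.+1) x - T (s j) x - d *: T (s j) y) (T (s j) x - (q j).1).
      lra.
    rewrite opprB [RHS](AC (3*2*2) (6*5*3*(1*7)*(2*4)))/=.
    by rewrite subrr addNr !addr0.
(* Telescoping over the blocks: a 0 is F(h)^n applied to the first node, and a K is
   the last node. *)
pose a j := iter (n - N j) (F h) (q j).1.
have Ha j : (j < K)%N -> `|a j - a j.+1| <= C * (C * (4 * (e1 * d))).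
  move=> jK; rewrite /a (_ : n - N j = (n - N j.+1) + (N j.+1 - N j))%N; last first.
    by rewrite addnBA ?subnK ?Nn// ltnW.
  rewrite iterD -(linB (lin_iter _ linh)).
  apply: (le_trans (Fh _ _ _)); first exact: leq_subr.
  by rewrite ler_pM2l// block.
have := norm_telescope Ha; rewrite /a N0E NKE subn0 subnn/= => H.
have [_ H1 _] := hq 0%N; have [_ H2 _] := hq K.
rewrite /s mul0r (c0_0 sgT) in H1; rewrite /s Kd in H2.
have := Fh n (x - (q 0%N).1) (leqnn _); rewrite (linB (lin_iter _ linh)) => H3.
have -> : iter n (F h) x - T t x = (iter n (F h) x - iter n (F h) (q 0%N).1)
   + (iter n (F h) (q 0%N).1 - (q K).1) - (T t x - (q K).1).
  by rewrite subrKA [in RHS]opprB subrKA.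
apply: (le_trans (ler_normB _ _)).
have H4 := ler_normD (iter n (F h) x - iter n (F h) (q 0%N).1) (iter n (F h) (q 0%N).1 - (q K).1).
have H5 : C * `|x - (q 0%N).1| <= C * (e1 * d / 3) by rewrite ler_pM2l.
have H6 : K%:R * (C * (C * (4 * (e1 * d)))) = 4 * C ^+ 2 * e1 * t.
  by rewrite -Kd; ring.
rewrite H6 in H.
have H7 : e1 * d <= e1 * t by rewrite ler_pM2l.
have C2 : C <= C ^+ 2 by rewrite expr2 ler_peMr// ltW.
have H8 : C * (e1 * d) <= C ^+ 2 * (e1 * t).
  by apply: ler_pM => //; rewrite ?mulr_ge0// ltW.
have H9 : e1 * d <= C ^+ 2 * (e1 * t).
  by apply: (le_trans H7); rewrite ler_peMl ?mulr_ge0//; lra.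
lra.
Unshelve. all: by end_near. Qed.

(** The maps F (t / n) ^ n and T t are bounded uniformly in n, so convergence on the
dense domain of the generator is convergence everywhere. *)
Theorem chernoff x t : 0 <= t -> iter n (F (t / n%:R)) x @[n --> \oo] --> T t x.
Proof.
rewrite le_eqVlt => /predU1P[<-|t0].
  rewrite (c0_0 sgT) (_ : (fun n => _) = cst x); first exact: cvg_cst.
  by apply/funext => n; rewrite mul0r; elim: n => //= n ->; rewrite F0.
apply/cvgrPdist_le => e e0.
set C := M * expR (t * w).
have C0 : 0 <= C by rewrite mulr_ge0 ?expR_ge0//; have := M1; lra.
have linT := c0_linear sgT (ltW t0).
have [c c0 hc] := op_norm_lty linT (c0_bounded sgT (ltW t0)).
have [k k0 kE] : exists2 k : R, 0 < k & (C + c + 1) * k = e.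
  exists (e / (C + c + 1)); first by rewrite divr_gt0//; lra.
  by field; lra.
have [y [z [yz xy]]] := generator_dense sgT x k0.
have H := chernoff_generator t0 yz k0; near=> n.
have n0 : (0 < n)%N by near: n; exact: nbhs_infty_gt.
have H1 : `|iter n (F (t / n%:R)) y - T t y| <= k by near: n.
set S := iter n (F (t / n%:R)) in H1 *.
have linS : linear S by apply/lin_iter/linF; rewrite divr_ge0// ltW.
have H2 := stable_upto (x - y) (ltW t0) n0 (leqnn n).
rewrite -/C -/S in H2.
have H3 := hc (x - y).
have -> : T t x - S x = T t (x - y) - (S y - T t y) - S (x - y).
  by rewrite (linB linT) (linB linS) opprB subrKA opprB subrKA.
have := ler_normB (T t (x - y) - (S y - T t y)) (S (x - y)).
have := ler_normB (T t (x - y)) (S y - T t y).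
have := ler_wpM2l C0 xy; have := ler_wpM2l c0 xy; lra.
Unshelve. all: by end_near. Qed.

End Chernoff.

(** * Completeness of the extended space *)

Section C0Complete.
Variables (R : realType) (E : completeNormedModType R).

Lemma C0_eval_le (f : C0 E) s : `|f s| <= `|f|.
Proof.
have [s0|s0] := leP 0 s; first exact: C0_norm_ub.
by have [-> //] := C0P f; rewrite normr0.
Qed.

(** Evaluations are contractions, so a Cauchy filter converges pointwise; the
convergence is uniform, which passes continuity and the limit 0 at infinity on. *)
Lemma C0_complete (F : set_system (C0 E)) : ProperFilter F -> cauchy F -> cvg F.
Proof.
move=> FF /cauchy_ballP cF.
pose l s := lim ((fun f : C0 E => f s) @ F).
have lP s : (fun f : C0 E => f s) @ F --> l s.
  apply: cauchy_cvg; apply/cauchy_ballP => e e0.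
  rewrite near_map2.
  have := cF e e0; apply: filterS => -[f g]/=; rewrite -!ball_normE /ball_/=.
  exact: le_lt_trans (C0_eval_le (f - g) s).
have ul (e : R) : 0 < e -> \forall f \near F, forall s, `|(f : C0 E) s - l s| <= e.
  move=> e0; have e20 : 0 < e / 2 by lra.
  have [[A A'] [/= FA FA'] AA'] := cF _ e20.
  near=> f => s; near F => g.
  have H1 : `|g s - l s| <= e / 2.
    by rewrite distrC; near: g; have /cvgrPdist_le := lP s; apply.
  have H2 : `|f s - g s| <= e / 2.
    apply: (le_trans (C0_eval_le (f - g) s)); apply: ltW.
    have : ball f (e / 2) g.
      by apply: (AA' (f, g)); split => /=; [near: f | near: g].
    by rewrite -ball_normE.
  by have := ler_distD (g s) (f s) (l s); lra.
have l0 (s : R) : s < 0 -> l s = 0.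
  move=> sn; apply/eqP; rewrite -normr_le0; apply/ler_addgt0Pr => e e0.
  have [f hf] := filter_ex (ul _ e0); have := hf s.
  by have [-> //] := C0P f; rewrite sub0r normrN add0r.
have lC : l \in @C0_pred R E.
  rewrite inE; split => //.
    apply/cont0yP => s e s0 e0; have e30 : 0 < e / 3 by lra.
    have [f hf] := filter_ex (ul _ e30).
    have [_ /cont0yP/(_ s _ s0 e30)[d d0 hd] _] := C0P f.
    exists d => // r r0 rs; have H1 := hd r r0 rs.
    have H2 := hf r; have H3 := hf s; rewrite distrC in H2.
    have := ler_distD (f r) (l r) (l s); have := ler_distD (f s) (f r) (l s); lra.
  apply/cvgrPdist_le => e e0; have e20 : 0 < e / 2 by lra.
  have [f hf] := filter_ex (ul _ e20).
  have [_ _ /cvgrPdist_le/(_ _ e20)] := C0P f.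
  apply: filterS => s; have := hf s; rewrite !sub0r !normrN => H1 H2.
  by have := ler_normB (f s) (f s - l s); rewrite opprB addrC subrK; lra.
apply/cvg_ex; exists (MkC0 lC).
apply/cvgrPdist_le => e e0; have := ul e e0; apply: filterS => f hf.
by apply: C0_norm_le => s s0; rewrite distrC; exact: hf.
Unshelve. all: by end_near. Qed.

HB.instance Definition _ := Uniform_isComplete.Build (C0 E) C0_complete.

End C0Complete.

Section ProdComplete.
Variables (R : realType) (U V : completeNormedModType R).

Lemma prod_complete (F : set_system ((U * V)%type : normedModType R)) :
  ProperFilter F -> cauchy F -> cvg F.
Proof.
move=> FF /cauchy_ballP cF.
have c1 : cvg (fst @ F).
  apply: cauchy_cvg; apply/cauchy_ballP => e e0.
  rewrite near_map2.
  by have := cF e e0; apply: filterS => -[f g]/= [].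
have c2 : cvg (snd @ F).
  apply: cauchy_cvg; apply/cauchy_ballP => e e0.
  rewrite near_map2.
  by have := cF e e0; apply: filterS => -[f g]/= [].
apply/cvg_ex; exists (lim (fst @ F), lim (snd @ F)).
have -> : F = (fun p : U * V => (p.1, p.2)) @ F.
  by rewrite (_ : (fun p : U * V => _) = id)//; apply/funext => -[].
exact: cvg_pair c1 c2.
Qed.

HB.instance Definition _ := Uniform_isComplete.Build (U * V)%type prod_complete.

End ProdComplete.

(** * Triangular operator matrices with a shift *)

Lemma ddsOpP (R : realType) (E : normedModType R) (f g : C0 E) (s e : R) :
  ddsOp (f, g) -> 0 <= s -> 0 < e ->
  exists2 d : R, 0 < d & forall h : R, h != 0 -> `|h| < d -> 0 <= s + h ->
    `|f (s + h) - f s - h *: g s| <= `|h| * e.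
Proof.
move=> fg s0 e0; have /cvgrPdist_le/(_ e e0) := fg s s0.
rewrite !near_withinE => /nbhs_ballP[d /= d0 hd].
exists d => // h h0 hhd sh.
have := hd h; rewrite /ball/= sub0r normrN => /(_ hhd h0 sh) H.
rewrite -normrN opprB -[f (s + h) - f s](scalerKV h0) -scalerBr normrZ.
by rewrite ler_wpM2l.
Qed.

(** The solutions of v' = dv/ds in C_0 are the left shifts, by characteristics:
s |-> v(s)(r + t - s) has derivative zero. *)
Lemma shift_unique (R : realType) (E : normedModType R) (v : R -> C0 E) :
  cont0y v ->
  (forall s, 0 <= s -> exists2 f', ddsOp (v s, f') & rderive v s f') ->
  forall t r, 0 <= t -> 0 <= r -> v t r = v 0 (r + t).
Proof.
move=> cv dv t r t0 r0.
(* The point on the characteristic, frozen for times beyond t. *)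
pose p s := r + Num.max 0 (t - s).
have p0 s : 0 <= p s by rewrite addr_ge0// le_max lexx.
pose f s := v s (p s).
have ev g s : 0 <= s -> `|(g : C0 E) s| <= `|g| by move=> s0; exact: C0_norm_ub.
suff : f t = f 0.
  rewrite /f /p subrr maxxx addr0 subr0 (_ : Num.max 0 t = t)//.
  exact/max_idPr.
apply/eqP; rewrite -subr_eq0 -normr_le0 -[leRHS](mulr0 (t - 0)).
apply: (@mean_value _ _ f 0 t 0); first by rewrite lexx.
  move=> s e s0 e0; have e20 : 0 < e / 2 by lra.
  have [d d0 hd] := cv s _ s0 e20.
  have [_ /cont0yP/(_ _ _ (p0 s) e20)[d' d'0 hd'] _] := C0P (v s).
  exists (Num.min d d') => [|s' s'0]; first by rewrite lt_min d0.
  rewrite lt_min => /andP[sd sd'].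
  have H1 := hd s' s'0 sd; have H2 := ev (v s' - v s) (p s') (p0 _).
  have H3 : `|v s (p s') - v s (p s)| <= e / 2.
    apply: hd' => //; apply: le_lt_trans sd'; rewrite /p.
    case: (leP 0 (t - s')) => ts'; case: (leP 0 (t - s)) => ts.
    - by rewrite (_ : r + _ - _ = - (s' - s)) ?normrN//; lra.
    - by rewrite ger0_norm ?ler0_norm; lra.
    - by rewrite ler0_norm ?ger0_norm; lra.
    - by rewrite subrr normr0.
  have := ler_distD (v s (p s')) (v s' (p s')) (v s (p s)).
  rewrite /f; move: H2; rewrite [(v s' - v s) _]/(_ - _); lra.
move=> s /andP[s0 st] e e0; have e30 : 0 < e / 3 by lra.
have [f' dvf dvs] := dv s s0.
have [d d0 hd] := dvs _ e30.
have [d' d'0 hd'] := ddsOpP dvf (p0 s) e30.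
have [_ /cont0yP/(_ _ _ (p0 s) e30)[d2 d20 hd2] _] := C0P f'.
exists (Num.min (t - s) (Num.min d (Num.min d' d2))) => [|h].
  by rewrite !lt_min d0 d'0 d20 !andbT; lra.
rewrite !lt_min => /andP[h0 /andP[hts /andP[hhd /andP[hhd' hhd2]]]].
have ps : p (s + h) = p s - h.
  by rewrite /p !(max_idPr _); lra.
have psh : 0 <= p s - h by rewrite -ps.
have H1 := hd h ltac:(lra).
have H2 := ev (v (s + h) - v s - h *: f') (p s - h) psh.
have H3 := hd' (- h) ltac:(rewrite oppr_eq0 gt_eqF//) ltac:(rewrite normrN gtr0_norm//) psh.
rewrite normrN gtr0_norm// in H3.
have H4 := hd2 (p s - h) psh.
rewrite (_ : p s - h - p s = - h) ?normrN ?gtr0_norm// in H4; last by lra.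
move: (H4 hhd2) => {}H4.
rewrite add0r.
have -> : f (s + h) - f s = (v (s + h) - v s - h *: f') (p s - h)
    + h *: (f' (p s - h) - f' (p s))
    + (v s (p s - h) - v s (p s) - (- h) *: f' (p s)).
  rewrite /f ps [(v (s + h) - v s - h *: f') _]/(_ - _ - _ *: _) scaleNr opprK scalerBr.
  rewrite [RHS](AC (3*2*3) (1*7*(2*6)*(3*4)*(5*8)))/=.
  by rewrite !addNr !addr0.
apply: (le_trans (ler_normD _ _)).
have := ler_normD ((v (s + h) - v s - h *: f') (p s - h)) (h *: (f' (p s - h) - f' (p s))).
rewrite [`|h *: _|]normrZ gtr0_norm//.
have : h * `|f' (p s - h) - f' (p s)| <= h * (e / 3) by rewrite ler_pM2l.
lra.
Qed.

(** Both operator matrices have the same shape, up to exchanging the two function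
components; pE, pF and pG stand for the component in E, the shifted component and
the constant component of Z. *)
Section Triangular.
Variables (R : realType) (E Z : completeNormedModType R).
Variables (T : R -> E -> E) (S : R -> Z -> Z).
Variables (pE : Z -> E) (pF pG : Z -> C0 E).
Hypotheses (sgT : c0_semigroup T) (sgS : c0_semigroup S).
Hypotheses (linE : linear pE) (linF : linear pF) (linG : linear pG).
Hypotheses (pE_le : forall z, `|pE z| <= `|z|) (pF_le : forall z, `|pF z| <= `|z|)
  (pG_le : forall z, `|pG z| <= `|z|).
Hypothesis genS : forall z z', generator S (z, z') ->
  [/\ generator T (pE z, pE z' - pF z 0), ddsOp (pF z, pF z') & pG z' = 0].

(** Estimates of bounded linear maps extend from the domain of the generator to the
whole space by density. *)
Lemma dense_bound (Y : normedModType R) (P : Z -> Y) (c l : R) (q : Z -> R) :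
  linear P -> (forall z, `|P z| <= c * `|z|) -> 0 <= c -> 0 <= l ->
  (forall z z', q z <= q z' + l * `|z - z'|) ->
  (forall z z', generator S (z, z') -> `|P z| <= q z) ->
  forall z, `|P z| <= q z.
Proof.
move=> linP Pc c0 l0 ql Pq z; apply/ler_addgt0Pr => e e0.
have [d d0 dE] : exists2 d : R, 0 < d & (c + l + 1) * d = e.
  exists (e / (c + l + 1)); first by rewrite divr_gt0//; lra.
  by field; lra.
have [y [y' [yS zy]]] := generator_dense sgS z d0.
have := Pq y y' yS; have := Pc (z - y); have := ql y z; rewrite distrC (linB linP).
have := ler_distD 0 (P z) (P y).
have := ler_normD (P z - P y) (P y); rewrite subrK.
have := ler_wpM2l c0 zy; have := ler_wpM2l l0 zy; lra.
Qed.

Lemma triangular_generator z z' t : generator S (z, z') -> 0 <= t ->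
  [/\ pG (S t z) = pG z, forall r, 0 <= r -> pF (S t z) r = pF z (r + t) &
   forall K, 0 <= K -> (forall s x, 0 <= s <= t -> `|T s x| <= K * `|x|) ->
     `|pE (S t z) - T t (pE z)| <= t * (K * `|pF z|)].
Proof.
move=> zz t0.
have one (Y : normedModType R) (p : Z -> Y) : (forall z, `|p z| <= `|z|) ->
    forall z, `|p z| <= 1 * `|z| by move=> H y; rewrite mul1r.
pose u s := S s z.
have cu : cont0y u by exact: orbit_cont0y.
have gu s : 0 <= s -> generator S (u s, S s z') by move=> s0; case: (generator_orbit sgS s0 zz).
have du s : 0 <= s -> rderive u s (S s z') by move=> s0; case: (generator_orbit sgS s0 zz).
have shiftF s r : 0 <= s -> 0 <= r -> pF (u s) r = pF z (r + s).
  move=> s0 r0; rewrite -[z in RHS](c0_0 sgS).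
  apply: (@shift_unique _ _ (fun s => pF (u s))) => //.
    exact: (cont0y_lin linF ler01 (one _ _ pF_le)).
  move=> q q0; have [_ H _] := genS (gu _ q0); exists (pF (S q z')) => //.
  exact: (rderive_lin linF ler01 (one _ _ pF_le) (du _ q0)).
split.
- rewrite -[z in RHS](c0_0 sgS).
  apply: (@cont0y_rderive_eq0 _ _ (fun s => pG (u s))) => //.
    exact: (cont0y_lin linG ler01 (one _ _ pG_le)).
  move=> s s0; have [_ _ <-] := genS (gu _ s0).
  exact: (rderive_lin linG ler01 (one _ _ pG_le) (du _ s0)).
- by move=> r r0; exact: shiftF.
- move=> K K0 TK; rewrite -[z in T t (pE z)](c0_0 sgS).
  apply: (@duhamel _ _ _ sgT (fun s => pE (u s))) => //.
    exact: (cont0y_lin linE ler01 (one _ _ pE_le)).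
  move=> s /andP[s0 _]; have [gT _ _] := genS (gu _ s0).
  exists (pE (S s z') - pF (u s) 0), (pE (S s z')); split => //.
    exact: (rderive_lin linE ler01 (one _ _ pE_le) (du _ s0)).
  rewrite opprB addrC subrK shiftF// add0r; exact: C0_eval_le.
Qed.

(** The description of the orbits that survives the passage from the domain to the whole
space: the contraction property replaces the explicit shift. *)
Lemma triangular_orbit z t : 0 <= t ->
  [/\ pG (S t z) = pG z, `|pF (S t z)| <= `|pF z| &
   forall K, 0 <= K -> (forall s x, 0 <= s <= t -> `|T s x| <= K * `|x|) ->
     `|pE (S t z) - T t (pE z)| <= t * (K * `|pF z|)].
Proof.
move=> t0; have linS := c0_linear sgS t0; have linT := c0_linear sgT t0.
have [c c0 hc] := op_norm_lty linS (c0_bounded sgS t0).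
split.
- apply/eqP; rewrite -subr_eq0 -normr_le0.
  apply: (@dense_bound _ (fun z => pG (S t z) - pG z) (c + 1) 0 (fun=> 0)) => //.
  + by move=> k x y; rewrite linS !linG scalerBr opprD addrACA.
  + move=> y; rewrite mulrDl mul1r; apply: (le_trans (ler_normB _ _)).
    by apply: lerD => //; apply: (le_trans (pG_le _)).
  + by lra.
  + by move=> y y' yy; have [-> _ _] := triangular_generator yy t0; rewrite subrr normr0.
- apply: C0_norm_le => r r0.
  suff -> : pF (S t z) r = pF z (r + t) by exact: C0_eval_le.
  apply/eqP; rewrite -subr_eq0 -normr_le0.
  apply: (@dense_bound _ (fun z => pF (S t z) r - pF z (r + t)) (c + 1) 0 (fun=> 0)) => //.
  + move=> k x y; rewrite linS !linF [(_ + _ : C0 E) r]/(_ *: _ + _).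
    by rewrite [(_ + _ : C0 E) (r + t)]/(_ *: _ + _) scalerBr opprD addrACA.
  + move=> y; rewrite mulrDl mul1r; apply: (le_trans (ler_normB _ _)).
    apply: lerD => //; last by apply: (le_trans (C0_eval_le _ _)).
    by apply: (le_trans (C0_eval_le _ _)); apply: (le_trans (pF_le _)).
  + by lra.
  + by move=> y y' yy; have [_ -> // _] := triangular_generator yy t0; rewrite subrr normr0.
- move=> K K0 TK.
  apply: (@dense_bound _ (fun z => pE (S t z) - T t (pE z)) (c + K) (t * K)
    (fun z => t * (K * `|pF z|))) => //.
  + by move=> k x y; rewrite linS !linE linT scalerBr opprD addrACA.
  + move=> y; rewrite mulrDl; apply: (le_trans (ler_normB _ _)).
    apply: lerD; first by apply: (le_trans (pE_le _)).
    apply: (le_trans (TK _ _ _)); first by rewrite t0 lexx.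
    by rewrite ler_wpM2l.
  + exact: addr_ge0.
  + exact: mulr_ge0.
  + move=> y y'; rewrite !mulrA -mulrDr ler_wpM2l ?mulr_ge0//.
    rewrite -lerBlDl; apply: le_trans (pF_le _); rewrite (linB linF).
    exact: lerB_dist.
  + by move=> y y' yy; have [_ _] := triangular_generator yy t0; exact.
Qed.

End Triangular.

(** * Stability of the splitting on the extended space *)

Lemma calA1E (R : realType) (E : normedModType R) (A : operator E) (z z' : calE E) :
  calA1 A (z, z') ->
  [/\ A (z.1.1, z'.1.1 - delta0 z.1.2), ddsOp (z.1.2, z'.1.2) & z'.2 = 0].
Proof.
move=> [x [f [g [x' [f' [Ax df Ez Ez']]]]]].
have {Ez} -> : z = (x, f, g) by exact: Ez.
have {Ez'} -> : z' = (x' + delta0 f, f', 0) by exact: Ez'.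
by rewrite /= addrK.
Qed.

Lemma calA2E (R : realType) (E : normedModType R) (A : operator E) (z z' : calE E) :
  calA2 A (z, z') ->
  [/\ A (z.1.1, z'.1.1 - delta0 z.2), ddsOp (z.2, z'.2) & z'.1.2 = 0].
Proof.
move=> [x [f [g [x' [f' [Ax df Ez Ez']]]]]].
have {Ez} -> : z = (x, f, g) by exact: Ez.
have {Ez'} -> : z' = (x' + delta0 g, 0, f') by exact: Ez'.
by rewrite /= addrK.
Qed.

Section ExtendedSpace.
Variables (R : realType) (E : completeNormedModType R).

(** The space calE again, together with its completeness. *)
Definition calEc : completeNormedModType R := (E * C0 E * C0 E)%type.

Lemma calE_norm (z : calEc) : `|z| = Num.max (Num.max `|z.1.1| `|z.1.2|) `|z.2|.
Proof. by rewrite !prod_normE. Qed.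

Lemma calE_norm_state (z : calEc) : `|z.1.1| <= `|z|.
Proof. by rewrite calE_norm !le_max lexx. Qed.

Lemma calE_norm_first (z : calEc) : `|z.1.2| <= `|z|.
Proof. by rewrite calE_norm !le_max lexx orbT. Qed.

Lemma calE_norm_second (z : calEc) : `|z.2| <= `|z|.
Proof. by rewrite calE_norm !le_max lexx orbT. Qed.

Lemma calA1_orbit (A : operator E) (T : R -> E -> E) (S : R -> calEc -> calEc) z t :
  generates A T -> generates (calA1 A) S -> 0 <= t ->
  [/\ (S t z).2 = z.2, `|(S t z).1.2| <= `|z.1.2| &
   forall K, 0 <= K -> (forall s x, 0 <= s <= t -> `|T s x| <= K * `|x|) ->
     `|(S t z).1.1 - T t z.1.1| <= t * (K * `|z.1.2|)].
Proof.
move=> [sgT AT] [sgS AS] t0.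
apply: (@triangular_orbit _ E calEc T S (fun z => z.1.1) (fun z => z.1.2) (fun z => z.2)) => //.
- exact: calE_norm_state.
- exact: calE_norm_first.
- exact: calE_norm_second.
move=> y y' yy; have /calA1E[] : calA1 A (y, y') by rewrite AS.
by rewrite AT.
Qed.

Lemma calA2_orbit (A : operator E) (T : R -> E -> E) (S : R -> calEc -> calEc) z t :
  generates A T -> generates (calA2 A) S -> 0 <= t ->
  [/\ (S t z).1.2 = z.1.2, `|(S t z).2| <= `|z.2| &
   forall K, 0 <= K -> (forall s x, 0 <= s <= t -> `|T s x| <= K * `|x|) ->
     `|(S t z).1.1 - T t z.1.1| <= t * (K * `|z.2|)].
Proof.
move=> [sgT AT] [sgS AS] t0.
apply: (@triangular_orbit _ E calEc T S (fun z => z.1.1) (fun z => z.2) (fun z => z.1.2)) => //.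
- exact: calE_norm_state.
- exact: calE_norm_second.
- exact: calE_norm_first.
move=> y y' yy; have /calA2E[] : calA2 A (y, y') by rewrite AS.
by rewrite AT.
Qed.

Section Step.
Variables (A1 A2 : operator E) (T1 T2 : R -> E -> E) (S1 S2 : R -> calEc -> calEc).
Hypotheses (gT1 : generates A1 T1) (gT2 : generates A2 T2).
Hypotheses (gS1 : generates (calA1 A1) S1) (gS2 : generates (calA2 A2) S2).

(** The function components are not enlarged, and the first component deviates from a
step of the unperturbed splitting by O(h), through each of the two perturbations. *)
Lemma calE_splitting_step (h K1 K2 b : R) (z : calEc) :
  0 <= h -> 1 <= K1 -> 1 <= K2 ->
  (forall s x, 0 <= s <= h -> `|T1 s x| <= K1 * `|x|) ->
  (forall s x, 0 <= s <= h -> `|T2 s x| <= K2 * `|x|) ->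
  `|z.1.2| <= b -> `|z.2| <= b ->
  [/\ `|(S2 h (S1 h z)).1.2| <= b, `|(S2 h (S1 h z)).2| <= b &
   `|T2 h (T1 h z.1.1) - (S2 h (S1 h z)).1.1| <= h * (2 * (K1 * K2 * b))].
Proof.
move=> h0 K11 K21 BK1 BK2 fb gb.
have b0 : 0 <= b by exact: le_trans fb.
have [K10 K20] : 0 <= K1 /\ 0 <= K2 by split; lra.
have [E1 le1 /(_ K1 K10 BK1) H1] := calA1_orbit z gT1 gS1 h0.
have [E2 le2 /(_ K2 K20 BK2) H2] := calA2_orbit (S1 h z) gT2 gS2 h0.
rewrite E1 in H2 le2; rewrite E2; split.
- exact: le_trans fb.
- exact: le_trans gb.
have linT2 := c0_linear gT2.1 h0.
have H3 := BK2 h ((S1 h z).1.1 - T1 h z.1.1) ltac:(rewrite h0 lexx//).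
rewrite (linB linT2) in H3.
rewrite distrC; apply: (le_trans (ler_distD (T2 h (S1 h z).1.1) _ _)).
have L1 : h * (K2 * `|z.2|) <= h * (K1 * K2 * b).
  by rewrite ler_wpM2l// ler_pM// ler_peMl.
have L2 : K2 * `|(S1 h z).1.1 - T1 h z.1.1| <= K2 * (h * (K1 * b)).
  by rewrite ler_wpM2l// (le_trans H1)// ler_wpM2l// ler_wpM2l.
lra.
Qed.

(** The n = t / h deviations of size O(h) add up to O(t), and 1 + 2 t <= exp (2 t). *)
Lemma calE_splitting_stable (M' w' : R) :
  1 <= M' -> 0 <= w' ->
  (forall h k x, 0 <= h ->
     `|iter k (T2 h \o T1 h) x| <= M' * expR (k%:R * h * w') * `|x|) ->
  exists M w : R, [/\ 1 <= M, 0 <= w & forall h k z, 0 <= h ->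
     `|iter k (S2 h \o S1 h) z| <= M * expR (k%:R * h * w) * `|z|].
Proof.
move=> M'1 w'0 stab.
have [M1 [w1 [M11 w10 B1]]] := semigroup_bound gT1.1.
have [M2 [w2 [M21 w20 B2]]] := semigroup_bound gT2.1.
exists (M' * M1 * M2), (w' + w1 + w2 + 2).
have M12 : 1 <= M1 * M2 by rewrite -[1]mulr1 ler_pM ?ler01.
have M1' : 1 <= M' * M1 * M2 by rewrite -mulrA -[1]mulr1 ler_pM ?ler01.
split => // [|h n z h0]; first by lra.
set t := n%:R * h.
have t0 : 0 <= t by rewrite mulr_ge0.
have [n0|n0] := eqVneq n 0%N.
  by rewrite /t n0 /= !mul0r expR0 mulr1 ler_peMl.
have ht : h <= t by rewrite ler_peMl// ler1n lt0n.
set C := M' * expR (t * w').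
set K1 := M1 * expR (t * w1); set K2 := M2 * expR (t * w2).
have expR1 (a : R) : 0 <= a -> 1 <= expR (t * a).
  by move=> a0; rewrite -expR0 ler_expR mulr_ge0.
have C1 : 1 <= C by rewrite -[1]mulr1 ler_pM ?ler01 ?expR1.
have K11 : 1 <= K1 by rewrite -[1]mulr1 ler_pM ?ler01 ?expR1.
have K21 : 1 <= K2 by rewrite -[1]mulr1 ler_pM ?ler01 ?expR1.
have BK1 s x : 0 <= s <= h -> `|T1 s x| <= K1 * `|x|.
  move=> /andP[s0 sh]; apply: (le_trans (B1 _ _ s0)); rewrite ler_wpM2r//.
  rewrite ler_wpM2l//; first lra.
  by rewrite ler_expR ler_wpM2r//; lra.
have BK2 s x : 0 <= s <= h -> `|T2 s x| <= K2 * `|x|.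
  move=> /andP[s0 sh]; apply: (le_trans (B2 _ _ s0)); rewrite ler_wpM2r//.
  rewrite ler_wpM2l//; first lra.
  by rewrite ler_expR ler_wpM2r//; lra.
pose u k := iter k (S2 h \o S1 h) z.
have next k := @calE_splitting_step h K1 K2 `|z| (u k) h0 K11 K21 BK1 BK2.
have fg k : `|(u k).1.2| <= `|z| /\ `|(u k).2| <= `|z|.
  elim: k => [|k [IH1 IH2]]; first by split; [exact: calE_norm_first | exact: calE_norm_second].
  by have [] := next k IH1 IH2.
have linG : linear (T2 h \o T1 h).
  by move=> k x y; rewrite /= (c0_linear gT1.1 h0) (c0_linear gT2.1 h0).
have step k : (k < n)%N ->
    `|(T2 h \o T1 h) (u k).1.1 - (u k.+1).1.1| <= h * (2 * (K1 * K2 * `|z|)).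
  by move=> _; have [fk gk] := fg k; have [] := next k fk gk.
have stabC i x : (i <= n)%N -> `|iter i (T2 h \o T1 h) x| <= C * `|x|.
  move=> ik; apply: (le_trans (stab _ _ _ h0)); rewrite ler_wpM2r// ler_wpM2l//; first lra.
  by rewrite ler_expR ler_wpM2r// ler_wpM2r// ler_nat.
have := iter_telescope linG stabC ltac:(lra) step.
rewrite /u /= -/(u n) => TE.
have S0 := stabC n z.1.1 (leqnn n).
have z0 : 0 <= `|z| by [].
have KK : 1 <= K1 * K2 by rewrite -[1]mulr1 ler_pM ?ler01.
have CKK : 1 <= C * (K1 * K2) by rewrite -[1]mulr1 ler_pM ?ler01.
have e2 : 1 + t * 2 <= expR (t * 2) by exact: expR_ge1Dx.
have bnd : C * (K1 * K2) * (1 + t * 2) * `|z|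
    <= M' * M1 * M2 * expR (t * (w' + w1 + w2 + 2)) * `|z|.
  rewrite ler_wpM2r//.
  rewrite (_ : t * (w' + w1 + w2 + 2) = t * w' + t * w1 + t * w2 + t * 2); last by ring.
  rewrite !expRD.
  apply: (@le_trans _ _ (C * (K1 * K2) * expR (t * 2))).
    by rewrite ler_wpM2l//; lra.
  by rewrite le_eqVlt; apply/orP; left; apply/eqP; rewrite /C /K1 /K2; ring.
apply: le_trans bnd.
have big1 : `|z| <= C * (K1 * K2) * (1 + t * 2) * `|z|.
  rewrite ler_peMl// -[1]mulr1 ler_pM ?ler01//; lra.
rewrite calE_norm !ge_max; apply/andP; split; last first.
  by apply: (le_trans (fg n).2).
apply/andP; split; last by apply: (le_trans (fg n).1).
have D := ler_distD 0 (u n).1.1 (iter n (T2 h \o T1 h) z.1.1).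
have := ler_normB (iter n (T2 h \o T1 h) z.1.1) (iter n (T2 h \o T1 h) z.1.1 - (u n).1.1).
rewrite opprB addrC subrK => /le_trans; apply.
have S1' : C * `|z.1.1| <= C * (K1 * K2) * `|z|.
  apply: (@le_trans _ _ (C * `|z|)); first by rewrite ler_wpM2l ?calE_norm_state//; lra.
  by rewrite ler_wpM2r// ler_peMr//; lra.
have TE' : n%:R * (C * (h * (2 * (K1 * K2 * `|z|)))) = C * (K1 * K2) * (t * 2) * `|z|.
  by rewrite /t; ring.
rewrite TE' in TE; lra.
Qed.

End Step.

End ExtendedSpace.

(** * The Lie and Strang splittings of two semigroups *)

Section Splitting.
Variables (R : realType) (X : completeNormedModType R).
Variables (A1 A2 : operator X) (S1 S2 : R -> X -> X).
Hypotheses (gen1 : generates A1 S1) (gen2 : generates A2 S2).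

Lemma semigroup_bound_upto (S : R -> X -> X) (t : R) : c0_semigroup S ->
  exists2 K : R, 1 <= K & forall s x, 0 <= s <= t -> `|S s x| <= K * `|x|.
Proof.
move=> sgS; have [M [w [M1 w0 B]]] := semigroup_bound sgS.
have [t0|t0] := leP 0 t; last by exists 1 => // s x; lra.
exists (M * expR (t * w)) => [|s x /andP[s0 st]].
  by rewrite -[1]mulr1 ler_pM ?ler01// -expR0 ler_expR mulr_ge0.
apply: (le_trans (B _ _ s0)); rewrite ler_wpM2r// ler_wpM2l//; first lra.
by rewrite ler_expR ler_wpM2r.
Qed.

Lemma splitting_linear h : 0 <= h -> linear (S2 h \o S1 h).
Proof. by move=> h0 k x y; rewrite /= (c0_linear gen1.1 h0) (c0_linear gen2.1 h0). Qed.

(** The increment S2 S1 y - y - h (a + b) is S2 (S1 y - y - h a), plus h (S2 a - a),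
plus S2 y - y - h b, and each of these is o(h). *)
Lemma splitting_consistent y z : op_sum A1 A2 (y, z) ->
  rderive (fun h => (S2 h \o S1 h) y) 0 z.
Proof.
move=> [a [b [/= Aa Ab ->]]] e e0.
have ga : generator S1 (y, a) by rewrite -gen1.2.
have gb : generator S2 (y, b) by rewrite -gen2.2.
have [K K1 BK] := semigroup_bound_upto 1 gen2.1.
have [k k0 kE] : exists2 k : R, 0 < k & (K + 2) * k = e.
  by exists (e / (K + 2)); [rewrite divr_gt0//; lra | field; lra].
have [d1 d10 h1] := iffLR (generatorP gen1.1 _ _) ga k k0.
have [d2 d20 h2] := iffLR (generatorP gen2.1 _ _) gb k k0.
have [d3 d30 h3] := orbit_cont0y gen2.1 a (lexx 0) k0.
exists (Num.min 1 (Num.min d1 (Num.min d2 d3))) => [|h].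
  by rewrite !lt_min ltr01 d10 d20.
rewrite !lt_min => /andP[h0 /andP[hh /andP[hd1 /andP[hd2 hd3]]]].
have lin2 := c0_linear gen2.1 (ltW h0).
have H1 := h1 h ltac:(rewrite h0//); have H2 := h2 h ltac:(rewrite h0//).
have H3 := h3 h (ltW h0) ltac:(rewrite subr0 gtr0_norm//).
rewrite add0r !(c0_0 gen1.1) in H1; rewrite add0r !(c0_0 gen2.1) in H2 H3.
rewrite add0r /= (c0_0 gen1.1) (c0_0 gen2.1).
have -> : S2 h (S1 h y) - y - h *: (a + b) = S2 h (S1 h y - y - h *: a)
    + h *: (S2 h a - a) + (S2 h y - y - h *: b).
  rewrite !(linB lin2) (linZ lin2) scalerDr scalerBr opprD.
  by rewrite [RHS](AC (3*2*3) (1*7*(5*8)*(2*6)*(3*4)))/= !addNr !addr0.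
have H4 := BK h (S1 h y - y - h *: a) ltac:(lra).
apply: (le_trans (ler_normD _ _)).
have := ler_normD (S2 h (S1 h y - y - h *: a)) (h *: (S2 h a - a)).
rewrite [`|h *: _|]normrZ gtr0_norm//.
have H5 : h * `|S2 h a - a| <= h * k by rewrite ler_pM2l.
have K0 : 0 <= K by lra.
have H6 := ler_wpM2l K0 H1.
rewrite -kE; lra.
Qed.

(** Since S1(2h) = S1(h) S1(h), moving one half-step across the product turns the
symmetric scheme into the plain one. *)
Lemma strang_intertwine h n x : 0 <= h ->
  iter n (S1 h \o S2 (2 * h) \o S1 h) (S1 h x) =
  S1 h (iter n (S2 (2 * h) \o S1 (2 * h)) x).
Proof.
move=> h0; elim: n => //= n ->; congr (S1 _ (S2 _ _)).
by rewrite (_ : 2 * h = h + h) ?(c0_D gen1.1)//; lra.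
Qed.

(** With g = h / 2 and G the symmetric step, G^n S1(g) = S1(g) (S2(h) S1(h))^n; as
g tends to 0 the two factors S1(g) disappear, the one on the left-hand side because
the powers of G are bounded. *)
Lemma strang_limit (T : R -> X -> X) (M w : R) x t :
  c0_semigroup T -> 1 <= M -> 0 <= w ->
  (forall h k x, 0 <= h ->
     `|iter k (S2 h \o S1 h) x| <= M * expR (k%:R * h * w) * `|x|) ->
  0 <= t ->
  iter n (S2 (t / n%:R) \o S1 (t / n%:R)) x @[n --> \oo] --> T t x ->
  iter n (S1 (t / (2 * n%:R)) \o S2 (t / n%:R) \o S1 (t / (2 * n%:R))) x
    @[n --> \oo] --> T t x.
Proof.
move=> sgT M1 w0 stab t0 lie.
have [K1 K11 B1] := semigroup_bound_upto t gen1.1.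
have [K2 K21 B2] := semigroup_bound_upto t gen2.1.
have [C C0 CE] : exists2 C, 0 <= C & C = M * expR (t * w).
  by exists (M * expR (t * w)) => //; rewrite mulr_ge0 ?expR_ge0//; lra.
pose D := K1 * (C * (K2 * K1)).
have D0 : 0 <= D by rewrite !mulr_ge0//; lra.
have K1_0 : 0 <= K1 by lra. have K2_0 : 0 <= K2 by lra.
apply/cvgrPdist_le => e e0.
have [k k0 kE] : exists2 k : R, 0 < k & (D + K1 + 1) * k = e.
  by exists (e / (D + K1 + 1)); [rewrite divr_gt0//; lra | field; lra].
have [d1 d10 h1] := orbit_cont0y gen1.1 x (lexx 0) k0.
have [d2 d20 h2] := orbit_cont0y gen1.1 (T t x) (lexx 0) k0.
near=> n.
have n0 : (0 < n)%N by near: n; exact: nbhs_infty_gt.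
have N0 : 0 < (n%:R : R) by rewrite ltr0n.
have N1 : 1 <= (n%:R : R) by rewrite ler1n.
have H1 : `|T t x - iter n (S2 (t / n%:R) \o S1 (t / n%:R)) x| <= k.
  by near: n; move/cvgrPdist_le: lie; apply.
have hE : t / (2 * n%:R) = t / n%:R / 2 by field; rewrite gt_eqF.
rewrite hE.
have hd1 : t / n%:R / 2 < d1.
  rewrite mulrAC ltr_pdivrMr// [ltRHS]mulrC -ltr_pdivrMr//.
  by near: n; exact: nbhs_infty_gtr.
have hd2 : t / n%:R / 2 < d2.
  rewrite mulrAC ltr_pdivrMr// [ltRHS]mulrC -ltr_pdivrMr//.
  by near: n; exact: nbhs_infty_gtr.
have ht : t / n%:R <= t by rewrite ler_pdivrMr// ler_peMr.
have h0 : 0 <= t / n%:R by rewrite divr_ge0// ltW.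
have nh : n%:R * (t / n%:R) = t by field; rewrite gt_eqF.
set h := t / n%:R in H1 hd1 hd2 ht h0 nh *.
clearbody h.
set g := h / 2; have g0 : 0 <= g by rewrite /g; lra.
have gt : g <= t by rewrite /g; lra.
have gE : 2 * g = h by rewrite /g; lra.
have lin1 := c0_linear gen1.1 g0.
have linG : linear (S1 g \o S2 h \o S1 g).
  by move=> c y z; rewrite /= lin1 (c0_linear gen2.1 h0) lin1.
have IW := strang_intertwine n x g0.
rewrite gE in IW.
set G := (S1 g \o S2 h \o S1 g) in linG IW *.
set P := iter n _ x in H1 IW.
(* G^(m+1) y = G^m (S1(g) S2(h) S1(g) y) reduces to the m-th power of S2(h) S1(h). *)
have BG y : `|iter n G y| <= D * `|y|.
  have [m mE] : exists m, n = m.+1 by exists n.-1; rewrite prednK.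
  rewrite mE.
  have IWm := strang_intertwine m (S2 h (S1 g y)) g0.
  rewrite gE -/G in IWm; rewrite iterSr (_ : G y = S1 g (S2 h (S1 g y)))// IWm.
  apply: (le_trans (B1 _ _ _)); first by rewrite g0.
  rewrite /D -!mulrA ler_wpM2l//.
  apply: (le_trans (stab _ _ _ h0)).
  have : M * expR (m%:R * h * w) <= C.
    rewrite CE ler_wpM2l//; first lra.
    by rewrite ler_expR ler_wpM2r// -nh ler_wpM2r// ler_nat mE.
  move=> MC; apply: ler_pM => //.
  - by rewrite mulr_ge0 ?expR_ge0//; lra.
  - apply: (le_trans (B2 _ _ _)); first by rewrite h0.
    by rewrite ler_wpM2l//; apply: B1; rewrite g0.
have -> : T t x - iter n G x = S1 g (T t x - P) - (S1 g (T t x) - T t x)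
    + iter n G (S1 g x - x).
  rewrite (linB lin1) (linB (lin_iter _ linG)) IW opprB.
  by rewrite [S1 g (T t x) - _ + _]addrC !subrKA.
have H2 := h1 g g0; rewrite subr0 ger0_norm// !(c0_0 gen1.1) in H2.
have H3 := h2 g g0; rewrite subr0 ger0_norm// !(c0_0 gen1.1) in H3.
have H4 := BG (S1 g x - x); have H5 := B1 g (T t x - P) ltac:(rewrite g0//).
have H6 := ler_wpM2l D0 (H2 hd1); have H7 := ler_wpM2l K1_0 H1.
have H8 := H3 hd2.
apply: (le_trans (ler_normD _ _)).
have := ler_normB (S1 g (T t x - P)) (S1 g (T t x) - T t x).
rewrite -kE; lra.
Unshelve. all: by end_near. Qed.

End Splitting.

Theorem proposition3p1 (R : realType) (E : completeNormedModType R)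
  (A1 A2 : operator E) (T1 T2 : R -> E -> E)
  (hT1 : generates A1 T1) (hT2 : generates A2 T2)
  (calT1 calT2 : R -> calE E -> calE E)
  (hcalT1 : generates (calA1 A1) calT1) (hcalT2 : generates (calA2 A2) calT2)
  (M' w' : R) (hM' : 1 <= M') (hw' : 0 <= w')
  (hstab : forall (t : R) (n : nat), 0 <= t -> (0 < n)%N ->
    (op_norm (iter n (T2 (t / n%:R) \o T1 (t / n%:R)))%R
      <= (M' * expR (t * w'))%:E)%E) :
  (exists M w : R, 1 <= M /\
    forall (t : R) (n : nat), 0 <= t -> (0 < n)%N ->
      (op_norm (iter n (calT2 (t / n%:R) \o calT1 (t / n%:R)))%R
        <= (M * expR (t * w))%:E)%E) /\
  (forall calT : R -> calE E -> calE E,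
    generates (op_closure (op_sum (calA1 A1) (calA2 A2))) calT ->
    forall (x : calE E) (t : R), 0 <= t ->
      (iter n (calT2 (t / n%:R) \o calT1 (t / n%:R)) x @[n --> \oo]
        --> calT t x) /\
      (iter n (calT1 (t / (2 * n%:R)) \o calT2 (t / n%:R)
                 \o calT1 (t / (2 * n%:R))) x @[n --> \oo]
        --> calT t x)).
Proof.
have stab h k x : 0 <= h ->
    `|iter k (T2 h \o T1 h) x| <= M' * expR (k%:R * h * w') * `|x|.
  move=> h0; have [->|k0] := posnP k.
    by rewrite /= !mul0r expR0 mulr1 ler_peMl.
  have K0 : (k%:R : R) != 0 by rewrite pnatr_eq0 -lt0n.
  move: x; apply/op_norm_leP.
  - by apply: lin_iter; exact: (splitting_linear hT1 hT2).
  - by rewrite mulr_ge0 ?expR_ge0//; lra.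
  - have := hstab (k%:R * h) k ltac:(exact: mulr_ge0) k0.
    by rewrite (_ : k%:R * h / k%:R = h)// mulrAC divff// mul1r.
have [M [w [M1 w0 cstab]]] :=
  calE_splitting_stable hT1 hT2 hcalT1 hcalT2 hM' hw' stab.
split.
  exists M, w; split => // t n t0 n0.
  have N0 : (n%:R : R) != 0 by rewrite pnatr_eq0 -lt0n.
  have h0 : 0 <= t / n%:R by exact: divr_ge0.
  apply/op_norm_leP.
  - apply: lin_iter; exact: (@splitting_linear R (calEc E) _ _ _ _ hcalT1 hcalT2).
  - by rewrite mulr_ge0 ?expR_ge0//; lra.
  - by move=> x; have := cstab (t / n%:R) n x h0; rewrite mulrCA divff// mulr1.
move=> calT [sgT genT] x t t0.
have lie : iter n (calT2 (t / n%:R) \o calT1 (t / n%:R)) x @[n --> \oo] --> calT t x.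
  apply: (@chernoff R (calEc E) (fun h => calT2 h \o calT1 h) M w
    (op_sum (calA1 A1) (calA2 A2)) calT) => //.
  - exact: (@splitting_linear R (calEc E) _ _ _ _ hcalT1 hcalT2).
  - by move=> y; rewrite /= (c0_0 hcalT1.1) (c0_0 hcalT2.1).
  - exact: (@splitting_consistent R (calEc E) _ _ _ _ hcalT1 hcalT2).
split => //.
exact: (@strang_limit R (calEc E) _ _ _ _ hcalT1 hcalT2 calT M w x t sgT M1 w0 cstab t0 lie).
Qed.
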